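(* Let $\tau\in\mathbb{C}$ with $\operatorname{Im}\tau>0$. Let $\varepsilon'$ and $m/p$ be rational numbers in $[0,1)$, with $\big[{}^{\ \varepsilon'}_{m/p}\big]\neq\big[{}^{1/2}_{1/2}\big]$, and suppose that multiplication by $3$ acts periodically, with period $\mathfrak{t}\geq 1$, on the ordered set of characteristics $$\mathcal{S}\big(\big[{}^{\ \varepsilon'}_{m/p}\big]\big)=\Big\{\mathfrak{T}^k\big[{}^{\ \varepsilon'}_{m/p}\big]\ \Big|\ 0\leq k\leq \mathfrak{t}-1\Big\},$$ i.e. $\mathfrak{t}$ is the least positive integer with $\mathfrak{T}^{\mathfrak{t}}\big[{}^{\ \varepsilon'}_{m/p}\big]=\big[{}^{\ \varepsilon'}_{m/p}\big]$. Then for every $0\leq k\leq\mathfrak{t}-1$, $$\theta'\big[{}^{\mathfrak{T}^{k}\varepsilon'}_{\mathfrak{T}^{k}m/p}\big]=\bigg((3^{\mathfrak{t}}-1)\prod_{l=0}^{\mathfrak{t}-1}\theta\big[{}^{\mathfrak{T}^{l}\varepsilon'}_{\mathfrak{T}^{l}m/p}\big]\bigg)^{-1}\theta'\big[{}^{1/2}_{1/2}\big]\,\theta\big[{}^{\mathfrak{T}^{k}\varepsilon'}_{\mathfrak{T}^{k}m/p}\big]\ \sum_{j=k}^{\mathfrak{t}-1+k}3^{\mathfrak{t}-1+k-j}\,E_j\ \theta^3\big[{}^{\frac12-2\cdot3^{j}\varepsilon'}_{\frac12-2\cdot3^{j}m/p}\big]\,\theta^{-2}\big[{}^{\mathfrak{T}^{j}\varepsilon'}_{\mathfrak{T}^{j}m/p}\big]\prod_{\substack{k\leq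 l\leq \mathfrak{t}-1+k\\ l\not\equiv j\ (\mathrm{mod}\ \mathfrak{t})\\ l\not\equiv j+1\ (\mathrm{mod}\ \mathfrak{t})}}\theta\big[{}^{\mathfrak{T}^{l}\varepsilon'}_{\mathfrak{T}^{l}m/p}\big],$$ where $$E_j=\exp\Big(6\pi i\big(1-\lfloor 3^{j}m/p\rfloor\big)\,\mathfrak{T}^{j}\varepsilon'-2\pi i\,\lfloor 3^{j+1}m/p\rfloor\,\mathfrak{T}^{j+1}\varepsilon'\Big),$$ and all theta functions and their derivatives are evaluated at $(0,\tau)$.
   Context: For $z\in\mathbb{C}$, $\tau\in\mathbb{C}$ with $\operatorname{Im}\tau>0$, and a characteristic $\big[{}^{\varepsilon'}_{\varepsilon}\big]\in\mathbb{R}^2$ (upper entry $\varepsilon'$, lower entry $\varepsilon$), the theta function with characteristic is $$\theta\big[{}^{\varepsilon'}_{\varepsilon}\big](z,\tau)=\sum_{n\in\mathbb{Z}}\exp\big(\pi i(n+\varepsilon')^2\tau+2\pi i(n+\varepsilon')(z+\varepsilon)\big).$$ The prime denotes the derivative in $z$: $\theta'\big[{}^{\varepsilon'}_{\varepsilon}\big](0,\tau)=\frac{\partial}{\partial z}\theta\big[{}^{\varepsilon'}_{\varepsilon}\big](z,\tau)\big|_{z=0}$. When arguments are omitted, $\theta[\cdot]$ means $\theta[\cdot](0,\tau)$ and $\theta'[\cdot]$ means $\theta'[\cdot](0,\tau)$; powers $\theta^3[\cdot]$, $\theta^{-2}[\cdot]$ are powers of these values. The operator $\mathfrak{T}$ of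 multiplication by $3$ acts on rational numbers $m/p\in[0,1)$ by $\mathfrak{T}\,m/p=(3m\bmod p)/p$, so that $\mathfrak{T}^k m/p=\big((3^k m)\bmod p\big)/p\in[0,1)$ (the fractional part of $3^k m/p$), and $\mathfrak{T}^0$ is the identity. It acts on a characteristic entrywise: $\mathfrak{T}^k\big[{}^{\varepsilon'}_{\varepsilon}\big]=\big[{}^{\mathfrak{T}^k\varepsilon'}_{\mathfrak{T}^k\varepsilon}\big]$. $\lfloor\cdot\rfloor$ is the floor function. An empty product equals $1$. *)

(* Defs.v *)
From mathcomp Require Import all_boot all_order all_algebra.
From mathcomp Require Import all_classical all_reals all_analysis.
From mathcomp.real_closed Require Import complex.

Set Implicit Arguments.
Unset Strict Implicit.
Unset Printing Implicit Defensive.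

Import Order.TTheory GRing.Theory Num.Theory.
Import numFieldNormedType.Exports.

Local Open Scope classical_set_scope.
Local Open Scope ring_scope.
Local Open Scope complex_scope.

Definition expC (R : realType) (z : R[i]) : R[i] :=
  (expR (complex.Re z))%:C * (cos (complex.Im z) +i* sin (complex.Im z)).

(* Sum over all integers, split into its one-sided series over n >= 0 and over
   n <= -1. [R[i]^o] carries the topology of the complex modulus, and [limn] is
   total: it is the limit whenever the latter exists. *)
Definition sumZ (R : realType) (f : int -> R[i]) : R[i] :=
  limn (fun N => \sum_(0 <= n < N) f n%:Z : R[i]^o) +
  limn (fun N => \sum_(0 <= n < N) f (- n.+1%:Z) : R[i]^o).

(* [a] is the upper and [b] the lower entry of the characteristic. *)
Definition theta (R : realType) (a b : R) (z tau : R[i]) : R[i] :=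
  sumZ (fun n : int =>
    expC (pi%:C * 'i%C * (n%:~R + a%:C) ^+ 2 * tau
          + 2 * pi%:C * 'i%C * (n%:~R + a%:C) * (z + b%:C))).

(* A rational characteristic is the pair (upper entry, lower entry). *)
Definition thetanull (R : realType) (c : rat * rat) (tau : R[i]) : R[i] :=
  theta (ratr c.1) (ratr c.2) 0 tau.

(* The field of scalars of [derive1] is [R[i]] itself: this is the complex
   derivative at z = 0. *)
Definition dthetanull (R : realType) (c : rat * rat) (tau : R[i]) : R[i] :=
  derive1 (fun z : R[i] => theta (ratr c.1) (ratr c.2) z tau : R[i]^o) 0.

(* For x = m / p in lowest terms, this is ((3 m) mod p) / p; by [mul3_frac] the
   choice of the representation m / p is irrelevant. *)
Definition mul3 (x : rat) : rat :=
  ((3 * numq x) %% denq x)%Z%:Q / (denq x)%:Q.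

Definition mul3c (c : rat * rat) : rat * rat := (mul3 c.1, mul3 c.2).

Definition least_period (c : rat * rat) (t : nat) : Prop :=
  [/\ (0 < t)%N, iter t mul3c c = c &
      forall s : nat, (0 < s < t)%N -> iter s mul3c c <> c].

Lemma modz_div_floor (m p : int) : 0 < p ->
  (m %% p)%Z%:Q / p%:Q = m%:Q / p%:Q - (Num.floor (m%:Q / p%:Q))%:~R.
Proof.
move=> p_gt0; have pQ_gt0 : (0 : rat) < p%:Q by rewrite ltr0z.
have E : m%:Q / p%:Q = (m %/ p)%Z%:Q + (m %% p)%Z%:Q / p%:Q.
  rewrite [in LHS](divz_eq m p) rmorphD rmorphM /= mulrDl mulfK //.
  by rewrite lt0r_neq0.
suff -> : Num.floor (m%:Q / p%:Q) = (m %/ p)%Z by rewrite E addrC addKr.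
apply: floor_def; rewrite E lerDl intrD /= ltrD2l.
rewrite divr_ge0 ?ler0z ?modz_ge0 ?(lt0r_neq0 p_gt0) ?(ltW p_gt0) //=.
by rewrite ltr_pdivrMr // mul1r ltr_int ltz_pmod.
Qed.

Lemma mul3_floor (x : rat) : mul3 x = 3 * x - (Num.floor (3 * x))%:~R.
Proof.
rewrite /mul3 modz_div_floor ?denq_gt0 // rmorphM /= -mulrA.
by rewrite divq_num_den.
Qed.

Lemma mul3_frac (m p : nat) : (0 < p)%N ->
  mul3 (m%:Q / p%:Q) = (3 * m %% p)%N%:Q / p%:Q.
Proof.
move=> p_gt0; rewrite mul3_floor -modz_nat modz_div_floor ?ltz_nat //.
by rewrite PoszM rmorphM /= mulrA.
Qed.

Lemma iter_mul3 (k : nat) (x : rat) : 0 <= x < 1 ->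
  iter k mul3 x = 3 ^+ k * x - (Num.floor (3 ^+ k * x))%:~R.
Proof.
move=> x01; elim: k => [|k IH] /=.
  by rewrite expr0 mul1r (_ : Num.floor x = 0) ?subr0 //; apply: floor_def.
rewrite IH mul3_floor mulrBr mulrA -exprS.
set F := Num.floor (3 ^+ k * x).
have -> : 3 * F%:~R = (3 * F)%:~R :> rat by rewrite rmorphM.
have -> : Num.floor (3 ^+ k.+1 * x - (3 * F)%:~R) =
          Num.floor (3 ^+ k.+1 * x) - 3 * F.
  by rewrite floorDrz ?rpredN ?intr_int //; congr (_ + _);
     rewrite -mulrNz; apply: intrKfloor.
by rewrite intrD mulrNz opprD opprK addrACA addNr addr0.
Qed.

(* Main.v *)
(* Write sigma for theta[1/2, 1/2]. Rearranging the double series of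
   sigma(u) sigma(v) according to the parity of the sum of the two indices gives
     sigma(u) sigma(v) = A(u + v) B(u - v) - B(u + v) A(u - v),
   where A and B are theta functions with modulus 2 tau. Such products are thus
   2x2 minors, and the Pluecker relation between them yields a three-term
   identity whose derivative is
     sigma'(0) sigma(2w)^3
       = sigma(w)^2 (3 sigma'(w) sigma(3w) - sigma(w) sigma'(3w)).
   In terms of characteristics it expresses 3 L_j - L_(j+1), where L_j is the
   logarithmic derivative at 0 of the theta function with the j-th
   characteristic; these relations, weighted by powers of 3, telescope around the
   cycle. One may divide by the theta constants since they do not vanish: by a
   finite form of Jacobi's triple product and Tannery's theorem,
   theta[a, b](0, tau) is, up to a nonzero factor, a convergent infinite product
   of nonzero factors unless a = b = 1/2 (for a, b in [0, 1)). *)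
Require Import Defs.
From mathcomp Require Import all_boot all_order all_algebra.
From mathcomp Require Import all_classical all_reals all_analysis.
From mathcomp.analysis Require Import showcase.summability.
From mathcomp.real_closed Require Import complex.
From mathcomp Require Import finmap ring lra zify.

Set Implicit Arguments.
Unset Strict Implicit.
Unset Printing Implicit Defensive.

Import Order.TTheory GRing.Theory Num.Theory.
Import numFieldNormedType.Exports.
Import Normc.

Local Open Scope classical_set_scope.
Local Open Scope ring_scope.
Local Open Scope complex_scope.

#[local] Existing Instance totally_filter.

(** * Unconditional sums of complex families *)

Lemma normcE (R : rcfType) (z : R[i]) : `|z| = (normc z)%:C.
Proof. by []. Qed.

Lemma normc_ge0 (R : rcfType) (z : R[i]) : 0 <= normc z.
Proof. by rewrite -ler0c -normcE. Qed.

Lemma ltr_normc (R : rcfType) (z : R[i]) (e : R) :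
  (`|z| < e%:C) = (normc z < e).
Proof. by rewrite normcE ltcR. Qed.

Lemma sum_fset_inj (V : nmodType) (I J : choiceType) (h : J -> I) (f : I -> V)
    (A : {fset J}) : injective h ->
  \sum_(i <- (h @` A)%fset) f i = \sum_(j <- A) f (h j).
Proof. by move=> hinj; rewrite big_imfset //; exact: in2W. Qed.

Section Csum.
Variable R : realType.
Local Notation C := R[i].

(** The norm of [R[i]] takes its values in [R[i]], so its epsilons are positive complex numbers;
    here convergence is tested with real ones. *)
Lemma cvg_normcP (T : Type) (F : set_system T) {FF : Filter F} (f : T -> C)
    (l : C) :
  (f : T -> C^o) @ F --> (l : C^o) <->
  (forall e : R, 0 < e -> \forall x \near F, normc (f x - l) < e).
Proof.
split=> [/cvgrPdistC_lt h e e0|h].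
  have e0' : (0 : C) < e%:C by rewrite ltcR.
  by near=> x; rewrite -ltr_normc; near: x; exact: h.
apply/cvgrPdistC_lt => e; rewrite ltcE /= => /andP[/eqP ie re].
have -> : e = (complex.Re e)%:C by case: e ie re => a b /= -> _.
by near=> x; rewrite ltr_normc; near: x; apply: h.
Unshelve. all: by end_near. Qed.

Definition fsum (I : choiceType) (f : I -> C) (F : {fset I}) : C :=
  \sum_(i <- F) f i.

(** The limit runs over the directed set of finite subsets of [I], so no enumeration is involved and
    series can be reindexed by any bijection. *)
Definition has_csum (I : choiceType) (f : I -> C) (s : C) : Prop :=
  (fsum f : _ -> C^o) @ totally --> (s : C^o).

Definition csum (I : choiceType) (f : I -> C) : C :=
  lim ((fsum f : _ -> C^o) @ totally).

Definition abs_bounded (I : choiceType) (f : I -> C) (M : R) : Prop :=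
  forall F : {fset I}, \sum_(i <- F) normc (f i) <= M.

Definition abs_summable (I : choiceType) (f : I -> C) : Prop :=
  exists M, abs_bounded f M.

Lemma has_csumE (I : choiceType) (f : I -> C) (s : C) :
  has_csum f s -> csum f = s.
Proof. by move=> hs; apply: (cvg_lim (@norm_hausdorff _ C^o) hs). Qed.

Lemma has_csumD (I : choiceType) (f g : I -> C) (s t : C) :
  has_csum f s -> has_csum g t -> has_csum (fun i => f i + g i) (s + t).
Proof.
move=> hf hg; rewrite /has_csum.
under eq_cvg do rewrite /fsum big_split /=.
exact: (cvgD hf hg).
Qed.

Lemma has_csumZ (I : choiceType) (f : I -> C) (s a : C) :
  has_csum f s -> has_csum (fun i => a * f i) (a * s).
Proof.
move=> hf; rewrite /has_csum.
under eq_cvg do rewrite /fsum -big_distrr /=.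
exact: (cvgMl_tmp hf).
Qed.

Lemma normc_sum (I : Type) (r : seq I) (f : I -> C) :
  normc (\sum_(i <- r) f i) <= \sum_(i <- r) normc (f i).
Proof.
elim/big_ind2: _ => [|x a y b ha hb|//]; first by rewrite normc0.
by apply: le_trans (le_normcD _ _) _; apply: lerD.
Qed.

Lemma sum_fset_le (I : choiceType) (f : I -> R) (A B : {fset I}) :
  (forall i, 0 <= f i) -> (A `<=` B)%fset ->
  \sum_(i <- A) f i <= \sum_(i <- B) f i.
Proof.
move=> f0 AB; rewrite [leRHS](big_fsetID _ (mem A)) /=.
have -> : [fset x in B | x \in A]%fset = A.
  by apply/fsetP => i; rewrite !inE andb_idl // => /(fsubsetP AB).
by rewrite lerDl sumr_ge0.
Qed.

Lemma normc_real (x : R) : normc x%:C = `|x|.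
Proof. by rewrite /= expr0n addr0 sqrtr_sqr. Qed.

Lemma abs_summableZ (I : choiceType) (f : I -> C) (a : C) :
  abs_summable f -> abs_summable (fun i => a * f i).
Proof.
case=> M fM; exists (normc a * M) => F.
apply: le_trans (ler_wpM2l (normc_ge0 a) (fM F)); rewrite big_distrr /=.
by apply: ler_sum => i _; rewrite normcM.
Qed.

Lemma abs_summableD (I : choiceType) (f g : I -> C) :
  abs_summable f -> abs_summable g -> abs_summable (fun i => f i + g i).
Proof.
move=> [M fM] [N gN]; exists (M + N) => F.
apply: le_trans (lerD (fM F) (gN F)); rewrite -big_split.
by apply: ler_sum => i _; exact: le_normcD.
Qed.

Lemma has_csum_ge0 (I : choiceType) (f : I -> R) (M : R) :
  (forall i, 0 <= f i) -> (forall F : {fset I}, \sum_(i <- F) f i <= M) ->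
  exists s : R, has_csum (fun i => (f i)%:C) s%:C.
Proof.
move=> f0 fM; pose E := [set x | exists F : {fset I}, x = \sum_(i <- F) f i].
have supE : has_sup E.
  by split; [exists (\sum_(i <- fset0) f i), fset0|exists M => _ [F ->]].
exists (sup E); apply/cvg_normcP => e e0.
have [_ [F ->] hF] := sup_adherent e0 supE.
exists F => // G /= FG; rewrite /fsum -rmorph_sum -rmorphB normc_real.
rewrite ler0_norm ?subr_le0; last by apply: sup_upper_bound => //; exists G.
by have := sum_fset_le f0 FG; lra.
Qed.

Lemma normr_Re_le (z : C) : `|complex.Re z| <= normc z.
Proof. by rewrite -lecR; exact: normc_ge_Re. Qed.

Lemma normr_Im_le (z : C) : `|complex.Im z| <= normc z.
Proof.
case: z => x y /=; rewrite -sqrtr_sqr ler_sqrt ?lerDr ?sqr_ge0 //.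
by rewrite addr_ge0 ?sqr_ge0.
Qed.

Lemma has_csum_real (I : choiceType) (f : I -> R) (M : R) :
  (forall F : {fset I}, \sum_(i <- F) `|f i| <= M) ->
  exists s : R, has_csum (fun i => (f i)%:C) s%:C.
Proof.
move=> fM.
have [s hs] := has_csum_ge0 (fun i => normr_ge0 (f i)) fM.
(* Both [|f|] and [|f| + f] are nonnegative, and [f] is their difference. *)
have [|F|t ht] := @has_csum_ge0 _ (fun i => `|f i| + f i) (M + M).
- by move=> i; have := ler_norm (- f i); rewrite normrN; lra.
- rewrite big_split lerD //; apply: le_trans (fM F).
  by apply: ler_sum => i _; exact: ler_norm.
exists (t + (-1) * s); have := has_csumD ht (has_csumZ (a := -1) hs).
have -> : (t + -1 * s)%:C = t%:C + -1 * s%:C by rewrite rmorphD rmorphM rmorphN1.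
congr (has_csum _ _); apply/funext => i.
by rewrite rmorphD /=; ring.
Qed.

Lemma abs_summable_has_csum (I : choiceType) (f : I -> C) :
  abs_summable f -> has_csum f (csum f).
Proof.
case=> M fM.
have [F|s hs] := @has_csum_real I (fun i => complex.Re (f i)) M.
  by apply: le_trans (fM F); apply: ler_sum => i _; exact: normr_Re_le.
have [F|t ht] := @has_csum_real I (fun i => complex.Im (f i)) M.
  by apply: le_trans (fM F); apply: ler_sum => i _; exact: normr_Im_le.
have := has_csumD hs (has_csumZ (a := 'i%C) ht).
under [X in has_csum X]eq_fun do rewrite -complexE.
by move=> h; rewrite (has_csumE h).
Qed.

Lemma csumZ (I : choiceType) (f : I -> C) (a : C) :
  abs_summable f -> csum (fun i => a * f i) = a * csum f.
Proof. by move=> /abs_summable_has_csum /(has_csumZ (a := a)) /has_csumE. Qed.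

Lemma csumD (I : choiceType) (f g : I -> C) :
  abs_summable f -> abs_summable g ->
  csum (fun i => f i + g i) = csum f + csum g.
Proof.
move=> /abs_summable_has_csum hf /abs_summable_has_csum hg.
by apply: has_csumE; apply: has_csumD.
Qed.

(** Along such a family the partial sums of an absolutely summable family tend to its full sum. It
    is used for images, boxes, initial segments and symmetric windows. *)
Definition cofinal (T : Type) (F : set_system T) (I : choiceType)
    (phi : T -> {fset I}) : Prop :=
  forall A : {fset I}, \forall x \near F, (A `<=` phi x)%fset.

Lemma cofinal_cvg (T : Type) (F : set_system T) {FF : Filter F}
    (I : choiceType) (phi : T -> {fset I}) : cofinal F phi ->
  phi @ F --> totally.
Proof.
move=> h P [A _ AP]; near=> x; apply: AP => /=; near: x; exact: h.
Unshelve. all: by end_near. Qed.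

Lemma csum_cofinal (T : Type) (F : set_system T) {FF : Filter F}
    (I : choiceType) (phi : T -> {fset I}) (f : I -> C) :
  abs_summable f -> cofinal F phi ->
  (fun x => fsum f (phi x) : C^o) @ F --> (csum f : C^o).
Proof.
move=> /abs_summable_has_csum hf /cofinal_cvg h.
exact: cvg_comp h hf.
Qed.

Lemma csum_unique (T : Type) (F : set_system T) {FF : ProperFilter F}
    (I : choiceType) (phi : T -> {fset I}) (f : I -> C) (s : C) :
  abs_summable f -> cofinal F phi ->
  (fun x => fsum f (phi x) : C^o) @ F --> (s : C^o) -> csum f = s.
Proof.
move=> af h hs; apply: (cvg_unique (@norm_hausdorff _ C^o) _ hs).
exact: csum_cofinal.
Qed.

Lemma abs_summable_inj (I J : choiceType) (h : J -> I) (f : I -> C) :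
  injective h -> abs_summable f -> abs_summable (f \o h).
Proof.
move=> hinj [M fM]; exists M => F /=.
by rewrite -(sum_fset_inj (fun i => normc (f i)) _ hinj).
Qed.

Lemma csum_bij (I J : choiceType) (h : J -> I) (f : I -> C) :
  bijective h -> abs_summable f -> csum (f \o h) = csum f.
Proof.
move=> hb af; have hinj := bij_inj hb; case: hb => k hk kh.
have hfilter := @totally_filter J.
symmetry; apply: (@csum_unique _ totally _ _ (fun A => h @` A)%fset) => //.
  move=> A; exists (k @` A)%fset => // B /= /fsubsetP AB.
  apply/fsubsetP => i iA; apply/imfsetP; exists (k i) => //=.
  by apply: AB; apply/imfsetP; exists i.
have -> : (fun A : {fset J} => fsum f (h @` A)%fset) = fsum (f \o h).
  by apply/funext => A; rewrite /fsum sum_fset_inj.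
exact: (abs_summable_has_csum (abs_summable_inj hinj af)).
Qed.

Lemma fsum_fsetX (I J : choiceType) (f : I -> C) (g : J -> C) A B :
  fsum (fun p : I * J => f p.1 * g p.2) (A `*` B)%fset = fsum f A * fsum g B.
Proof.
rewrite /fsum big_distrl /=; under [RHS]eq_bigr do rewrite big_distrr /=.
rewrite [LHS](perm_big [seq (i, j) | i <- A, j <- B]).
  by rewrite big_allpairs.
apply: uniq_perm; rewrite ?fset_uniq ?allpairs_uniq ?fset_uniq //.
  by move=> [? ?] [? ?].
move=> [i j]; rewrite in_fsetM /=.
apply/andP/allpairsP => [[iA jB]|[[a b] /= [aA bB [-> ->]]]//].
by exists (i, j).
Qed.

Lemma abs_summable_prod (I J : choiceType) (f : I -> C) (g : J -> C) :
  abs_summable f -> abs_summable g ->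
  abs_summable (fun p : I * J => f p.1 * g p.2).
Proof.
move=> [M fM] [N gN]; exists (M * N) => F.
pose A := [fset p.1 | p in F]%fset; pose B := [fset p.2 | p in F]%fset.
have FAB : (F `<=` A `*` B)%fset.
  apply/fsubsetP => p pF; rewrite in_fsetM.
  by apply/andP; split; apply/imfsetP; exists p.
apply: le_trans (sum_fset_le (fun p => normc_ge0 (f p.1 * g p.2)) FAB) _.
rewrite -lecR rmorph_sum rmorphM /=.
under eq_bigr do rewrite normcM rmorphM /=.
rewrite [leLHS](fsum_fsetX (fun i => (normc (f i))%:C)
                 (fun j => (normc (g j))%:C)).
rewrite /fsum -!rmorph_sum -!rmorphM lecR.
by apply: ler_pM; rewrite ?fM ?gN ?sumr_ge0 // => i _; exact: normc_ge0.
Qed.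

(** Boxes [A * B] are cofinal among the finite subsets of the product, and on a box the double sum
    factors. *)
Lemma csum_prod (I J : choiceType) (f : I -> C) (g : J -> C) :
  abs_summable f -> abs_summable g ->
  csum (fun p : I * J => f p.1 * g p.2) = csum f * csum g.
Proof.
move=> af ag.
pose phi (P : {fset I} * {fset J}) := (P.1 `*` P.2)%fset.
apply: (@csum_unique _ (filter_prod totally totally) _ _ phi).
- exact: abs_summable_prod.
- move=> A; exists ([set B | ([fset p.1 | p in A] `<=` B)%fset],
                    [set B | ([fset p.2 | p in A] `<=` B)%fset]).
    by split => /=; [exists [fset p.1 | p in A]%fset
                    |exists [fset p.2 | p in A]%fset].
  move=> [B D] /= [/fsubsetP AB /fsubsetP AD]; apply/fsubsetP => p pA.
  rewrite in_fsetM; apply/andP; split.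
    by apply: AB; apply/imfsetP; exists p.
  by apply: AD; apply/imfsetP; exists p.
- under eq_cvg do rewrite fsum_fsetX.
  apply: (@cvgM C).
    exact: (@cvg_comp _ _ _ fst (fsum f : _ -> C^o) _ _ _ cvg_fst (abs_summable_has_csum af)).
  exact: (@cvg_comp _ _ _ snd (fsum g : _ -> C^o) _ _ _ cvg_snd (abs_summable_has_csum ag)).
Qed.

Lemma csum_sum (I J : choiceType) (f : I + J -> C) :
  abs_summable f -> csum f = csum (f \o inl) + csum (f \o inr).
Proof.
move=> af.
have inl_inj : injective (@inl I J) by move=> ? ? [].
have inr_inj : injective (@inr I J) by move=> ? ? [].
pose phi (P : {fset I} * {fset J}) : {fset I + J} :=
  ([fset inl i | i in P.1] `|` [fset inr j | j in P.2])%fset.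
apply: (@csum_unique _ (filter_prod totally totally) _ _ phi) => //.
- move=> A.
  pose A1 : {fset I} := [fset i | i in
    pmap (fun p : I + J => if p is inl i then Some i else None) A]%fset.
  pose A2 : {fset J} := [fset i | i in
    pmap (fun p : I + J => if p is inr i then Some i else None) A]%fset.
  exists ([set B | (A1 `<=` B)%fset], [set B | (A2 `<=` B)%fset]).
    by split => /=; [exists A1|exists A2].
  move=> [B D] /= [/fsubsetP AB /fsubsetP AD]; apply/fsubsetP => -[i|j] pA.
    rewrite in_fsetU; apply/orP; left; apply/imfsetP; exists i => //=.
    apply: AB; rewrite in_fset /= mem_pmap.
    by apply/mapP; exists (inl i).
  rewrite in_fsetU; apply/orP; right; apply/imfsetP; exists j => //=.
  apply: AD; rewrite in_fset /= mem_pmap.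
  by apply/mapP; exists (inr j).
- have E P : fsum f (phi P) = fsum (f \o inl) P.1 + fsum (f \o inr) P.2.
    rewrite /fsum (big_fsetID _ (fun p : I + J => if p is inl _ then true else false)).
    congr (_ + _).
      rewrite -(sum_fset_inj f _ inl_inj).
      apply: eq_fbigl => -[i|j]; rewrite !inE /= ?andbT ?andbF.
        rewrite [X in _ || X](_ : _ = false) ?orbF //.
        by apply/negbTE/imfsetP => -[].
      by symmetry; apply/negbTE/imfsetP => -[].
    rewrite -(sum_fset_inj f _ inr_inj).
    apply: eq_fbigl => -[i|j]; rewrite !inE /= ?andbT ?andbF.
      by symmetry; apply/negbTE/imfsetP => -[].
    rewrite [X in X || _](_ : _ = false) ?orbF //.
    by apply/negbTE/imfsetP => -[].
  under eq_cvg do rewrite E.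
  apply: (@cvgD _ C^o).
    exact: (@cvg_comp _ _ _ fst (fsum (f \o inl) : _ -> C^o) _ _ _ cvg_fst
      (abs_summable_has_csum (abs_summable_inj inl_inj af))).
  exact: (@cvg_comp _ _ _ snd (fsum (f \o inr) : _ -> C^o) _ _ _ cvg_snd
      (abs_summable_has_csum (abs_summable_inj inr_inj af))).
Qed.

Lemma cofinal_iota :
  cofinal \oo (fun N : nat => [fset i | i in iota 0 N]%fset).
Proof.
move=> A; exists (\max_(i <- A) i).+1 => // N /= AN.
apply/fsubsetP => i iA; rewrite in_fset /= mem_iota /=.
by apply: leq_trans AN; rewrite ltnS; apply: leq_bigmax_seq.
Qed.

Lemma cvg_csum_nat (f : nat -> C) : abs_summable f ->
  (fun N => \sum_(0 <= n < N) f n : C^o) @ \oo --> (csum f : C^o).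
Proof.
move=> af; have := csum_cofinal (FF := eventually_filter) af cofinal_iota.
suff -> : (fun N => fsum f [fset i | i in iota 0 N]%fset) =
  (fun N => \sum_(0 <= n < N) f n) by [].
apply/funext => N; rewrite /fsum /index_iota subn0.
rewrite [LHS](perm_big (iota 0 N)) //.
apply: uniq_perm; rewrite ?fset_uniq ?iota_uniq // => i.
by rewrite in_fset.
Qed.

(** Absolute summability makes both one-sided limits in [sumZ] exist, so neither [limn] returns a
    default value. *)
Lemma sumZ_csum (f : int -> C) : abs_summable f -> sumZ f = csum f.
Proof.
move=> af.
have pinj : injective Posz by move=> ? ? [].
have ninj : injective (fun n : nat => - n.+1%:Z) by move=> m n; lia.
pose h (p : nat + nat) : int :=
  match p with inl n => n%:Z | inr n => - n.+1%:Z end.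
have hbij : bijective h.
  exists (fun n : int => match n with Posz n => inl n | Negz n => inr n end).
    by case=> n.
  by case=> n //=; rewrite NegzE.
rewrite -(csum_bij hbij af) csum_sum; last first.
  exact: abs_summable_inj (bij_inj hbij) af.
have hp := cvg_csum_nat (abs_summable_inj pinj af).
have hn := cvg_csum_nat (abs_summable_inj ninj af).
rewrite /sumZ; congr (_ + _).
  exact: (cvg_lim (@norm_hausdorff _ C^o) hp).
exact: (cvg_lim (@norm_hausdorff _ C^o) hn).
Qed.

Lemma normc_csum_le (I : choiceType) (f : I -> C) (M : R) :
  abs_bounded f M -> normc (csum f) <= M.
Proof.
move=> fM; apply/ler_addgt0Pr => e e0.
have /abs_summable_has_csum /cvg_normcP /(_ e e0) [A _ /(_ A)] :
  abs_summable f by exists M.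
rewrite /= fsubset_refl => /(_ isT) h.
have -> : csum f = fsum f A - (fsum f A - csum f) by ring.
apply: le_trans (le_normcD _ _) _; rewrite normcN; apply: lerD; last exact: ltW.
by apply: le_trans (normc_sum _ _) _; exact: fM.
Qed.

(** Take [A] whose sum of norms is within [e] of the supremum; a disjoint [B] can only add what is
    left. *)
Lemma abs_summable_tail (I : choiceType) (f : I -> C) (e : R) :
  abs_summable f -> 0 < e ->
  exists A : {fset I}, forall B : {fset I}, [disjoint A & B]%fset ->
    \sum_(i <- B) normc (f i) < e.
Proof.
move=> [M fM] e0.
pose E := [set x | exists F : {fset I}, x = \sum_(i <- F) normc (f i)].
have supE : has_sup E.
  split; [exists (\sum_(i <- fset0) normc (f i)), fset0 => //|].
  by exists M => _ [F ->]; exact: fM.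
have [_ [A ->] hA] := sup_adherent e0 supE.
exists A => B AB.
have : \sum_(i <- (A `|` B)%fset) normc (f i) <= sup E.
  by apply: sup_upper_bound => //; exists (A `|` B)%fset.
rewrite (big_fsetID _ (mem A)) /=.
have -> : [fset x in (A `|` B)%fset | x \in A]%fset = A.
  by apply/fsetP => i; rewrite !inE; case: (i \in A); rewrite ?andbF.
have -> : [fset x in (A `|` B)%fset | x \notin A]%fset = B.
  apply/fsetP => i; rewrite !inE; case: (boolP (i \in A)) => /= [iA|_].
    by rewrite ?andbF (negbTE (fdisjointP AB i iA)).
  by rewrite ?andbT.
by move: hA; lra.
Qed.

(* Tannery's theorem. *)
Lemma cvg_fsum_weighted (I : choiceType) (f : I -> C) (phi : nat -> {fset I})
    (c : nat -> I -> C) (l : C) (K : R) :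
  abs_summable f -> cofinal \oo phi ->
  (forall n i, i \in phi n -> normc (c n i) <= K) ->
  (forall i, (c ^~ i : nat -> C^o) @ \oo --> (l : C^o)) ->
  (fun n => fsum (fun i => c n i * f i) (phi n) : C^o) @ \oo -->
    (l * csum f : C^o).
Proof.
move=> af cphi cK cl.
suff h : (fun n => fsum (fun i => (c n i - l) * f i) (phi n) : C^o) @ \oo -->
    (0 : C^o).
  have -> : (fun n => fsum (fun i => c n i * f i) (phi n)) =
      (fun n => fsum (fun i => (c n i - l) * f i) (phi n) + l * fsum f (phi n)).
    apply/funext => n; rewrite /fsum big_distrr /= -big_split /=.
    by apply: eq_bigr => i _; ring.
  have h2 : (fun n => l * fsum f (phi n) : C^o) @ \oo --> (l * csum f : C^o).
    by apply: (@cvgMl_tmp C); exact: csum_cofinal.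
  have h3 := @cvgD _ C^o _ _ _ _ _ _ _ h h2.
  rewrite add0r in h3.
  exact: h3.
apply/cvg_normcP => e e0.
(* [K'] is positive and bounds [normc (c n i - l)]. Outside [A] the norms of [f] sum to less than
   [e / (2 * K')], so the part over [A] and the tail cost at most [e / 2] each. *)
pose K' := `|K| + normc l + 1.
have K'0 : 0 < K' by rewrite ltr_wpDl // addr_ge0 // normc_ge0.
have [A hA] := abs_summable_tail af (divr_gt0 e0 (mulr_gt0 (ltr0Sn _ 1) K'0)).
have : (fun n => \sum_(i <- A) (c n i - l) * f i : C^o) @ \oo --> (0 : C^o).
  have h0 i : (fun n => (c n i - l) * f i : C^o) @ \oo --> (0 * f i : C^o).
    apply: (@cvgMr_tmp C).
    have h1 := @cvgB _ C^o _ _ _ _ _ _ _ (cl i) (cvg_cst (l : C^o)).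
    rewrite subrr in h1.
    exact: h1.
  elim: (enum_fset A) => [|i r IH].
    under eq_cvg do rewrite big_nil.
    exact: (@cvg_cst C^o).
  under eq_cvg do rewrite big_cons.
  have h1 := @cvgD _ C^o _ _ _ _ _ _ _ (h0 i) IH.
  rewrite mul0r add0r in h1.
  exact: h1.
move=> /cvg_normcP /(_ (e / 2)) hA2.
have cA := cphi A.
near=> n.
have An : (A `<=` phi n)%fset by near: n.
rewrite subr0 /fsum (big_fsetID _ (mem A)) /=.
have -> : [fset x in phi n | x \in A]%fset = A.
  by apply/fsetP => i; rewrite !inE andb_idl // => /(fsubsetP An).
apply: le_lt_trans (le_normcD _ _) _.
rewrite (splitr e); apply: ltr_leD.
  rewrite -[X in normc X]subr0; near: n; apply: hA2; exact: divr_gt0.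
apply: le_trans (normc_sum _ _) _.
apply: (@le_trans _ _ (\sum_(i <- [fset x in phi n | x \notin A]%fset)
                          K' * normc (f i))).
  rewrite [leLHS]big_seq_cond [leRHS]big_seq_cond.
  apply: ler_sum => i; rewrite andbT !inE => /andP[ip _]; rewrite normcM.
  rewrite ler_wpM2r ?normc_ge0 //.
  apply: le_trans (le_normcD _ _) _; rewrite normcN.
  have := cK _ _ ip; have := ler_norm K; rewrite /K'; lra.
rewrite -big_distrr /= -ler_pdivlMl //; apply: ltW.
rewrite [ltRHS](_ : _ = e / (2 * K')); last by rewrite invfM; ring.
apply: hA; apply/fdisjointP => i iA; rewrite !inE iA andbF //.
Unshelve. all: by end_near. Qed.

End Csum.

(** * The complex exponential and Gaussian bounds *)

Section ExpC.
Variable R : realType.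
Local Notation C := R[i].

Lemma cReD (z w : C) : complex.Re (z + w) = complex.Re z + complex.Re w.
Proof. by case: z w => [a b] [c d]. Qed.

Lemma cImD (z w : C) : complex.Im (z + w) = complex.Im z + complex.Im w.
Proof. by case: z w => [a b] [c d]. Qed.

Lemma cReM (z w : C) :
  complex.Re (z * w) = complex.Re z * complex.Re w - complex.Im z * complex.Im w.
Proof. by case: z w => [a b] [c d]. Qed.

Lemma cImM (z w : C) :
  complex.Im (z * w) = complex.Re z * complex.Im w + complex.Im z * complex.Re w.
Proof. by case: z w => [a b] [c d]. Qed.

Lemma expCD (z w : C) : expC (z + w) = expC z * expC w.
Proof.
rewrite /expC cReD cImD expRD cosD sinD rmorphM /= -!mulrA; congr (_ * _).
rewrite [RHS]mulrCA; congr (_ * _).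
by apply/eqP; rewrite eq_complex /=; apply/andP; split; apply/eqP; ring.
Qed.

Lemma expC0 : expC 0 = 1 :> C.
Proof. by rewrite /expC /= expR0 cos0 sin0 mul1r. Qed.

Lemma expC_neq0 (z : C) : expC z != 0.
Proof.
apply/eqP => h; have := expCD z (- z).
by rewrite subrr expC0 h mul0r => /eqP; rewrite oner_eq0.
Qed.

Lemma expCN (z : C) : expC (- z) = (expC z)^-1.
Proof.
by apply: (mulfI (expC_neq0 z)); rewrite -expCD subrr expC0 divff ?expC_neq0.
Qed.

Lemma expCX (z : C) (n : nat) : expC z ^+ n = expC (z *+ n).
Proof.
elim: n => [|n IH]; first by rewrite expr0 mulr0n expC0.
by rewrite exprS mulrS expCD IH.
Qed.

Lemma normc_expC (z : C) : normc (expC z) = expR (complex.Re z).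
Proof.
rewrite /expC normcM normc_real ger0_norm ?expR_ge0 //.
by rewrite /= cos2Dsin2 sqrtr1 mulr1.
Qed.

Lemma expC_pi : expC (pi%:C * 'i%C) = -1 :> C.
Proof.
rewrite /expC /= !mulr0 !mul0r !mulr1 subr0 addr0 expR0 mul1r cospi sinpi.
by apply/eqP; rewrite eq_complex /= oppr0 !eqxx.
Qed.

Lemma expC_2pi_int (n : int) : expC (2 * pi%:C * 'i%C * n%:~R) = 1 :> C.
Proof.
have h (m : nat) : expC (2 * pi%:C * 'i%C * m%:R) = 1 :> C.
  rewrite mulr_natr -expCX [X in expC X](_ : _ = pi%:C * 'i%C + pi%:C * 'i%C).
    by rewrite expCD expC_pi mulrNN mulr1 expr1n.
  by ring.
case: n => n; first exact: h.
by rewrite NegzE mulrNz mulrN expCN h invr1.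
Qed.

Lemma expC_period (z w : C) (n : int) : z = w + 2 * pi%:C * 'i%C * n%:~R ->
  expC z = expC w.
Proof. by move=> ->; rewrite expCD expC_2pi_int mulr1. Qed.

Lemma expC_antiperiod (z w : C) (n : int) :
  z = w + pi%:C * 'i%C + 2 * pi%:C * 'i%C * n%:~R -> expC z = - expC w.
Proof. by move=> ->; rewrite !expCD expC_2pi_int expC_pi mulr1 mulrN1. Qed.

(** Mean value inequality based at 0. Applied repeatedly, each bound feeding the next, it gives the
    Taylor estimates below with crude constants. *)
Lemma MVT_bound (f f' : R -> R) (M x : R) :
  (forall t, is_derive t (1 : R) f (f' t)) ->
  (forall t, `|t| <= `|x| -> `|f' t| <= M) -> `|f x - f 0| <= M * `|x|.
Proof.
move=> df hM.
have cf a b : {within `[a, b], continuous f}.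
  apply: derivable_within_continuous => t _.
  by have := df t; case.
have [x0|x0] := leP 0 x.
  have [t] := MVT_segment x0 (fun t _ => df t) (cf _ _).
  rewrite in_itv /= => /andP[t0 tx] ->; rewrite subr0 normrM ler_wpM2r //.
  by apply: hM; rewrite !ger0_norm //.
have [t] := MVT_segment (ltW x0) (fun t _ => df t) (cf _ _).
rewrite in_itv /= => /andP[xt t0].
rewrite distrC => ->; rewrite sub0r normrM normrN ler_wpM2r //.
by apply: hM; rewrite !ler0_norm ?lerN2 // ltW.
Qed.

Lemma normr_sin_le (x : R) : `|sin x| <= `|x|.
Proof.
have := @MVT_bound sin cos 1 x; rewrite sin0 subr0 mul1r; apply => // t _.
exact: cos_max.
Qed.

Lemma normr_cos_sub1 (x : R) : `|cos x - 1| <= `|x| ^+ 2.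
Proof.
have := @MVT_bound cos (fun t => - sin t) `|x| x; rewrite cos0 -expr2; apply => t.
by rewrite normrN; apply: le_trans; exact: normr_sin_le.
Qed.

Lemma normr_sin_sub (x : R) : `|sin x - x| <= `|x| ^+ 2.
Proof.
have := @MVT_bound (fun t => sin t - t) (fun t => cos t - 1) `|x| x.
rewrite sin0 subrr subr0 -expr2; apply => t; apply: le_trans.
have := @MVT_bound cos (fun u => - sin u) 1 t; rewrite cos0 mul1r; apply => u _.
by rewrite normrN; exact: sin_max.
Qed.

Lemma normr_expR_sub1 (x : R) : `|expR x - 1| <= `|x| * expR `|x|.
Proof.
have := @MVT_bound expR expR (expR `|x|) x; rewrite expR0 mulrC; apply => t h.
by rewrite ger0_norm ?expR_ge0 // ler_expR (le_trans (ler_norm t)).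
Qed.

Lemma normr_expR_sub (x : R) : `|expR x - 1 - x| <= `|x| ^+ 2 * expR `|x|.
Proof.
have := @MVT_bound (fun t => expR t - t) (fun t => expR t - 1)
  (`|x| * expR `|x|) x.
rewrite expR0 subr0 mulrAC -expr2 addrAC; apply => t h.
apply: le_trans (normr_expR_sub1 t) _.
by rewrite ler_pM ?expR_ge0 // ler_expR.
Qed.

Lemma normc_le_ReIm (z : C) : normc z <= `|complex.Re z| + `|complex.Im z|.
Proof.
have E : z = (complex.Re z)%:C + 'i%C * (complex.Im z)%:C by rewrite -complexE.
rewrite {1}E; apply: le_trans (le_normcD _ _) _.
rewrite normcM !normc_real [X in X * _](_ : _ = 1) ?mul1r //.
by rewrite /= expr0n expr1n add0r sqrtr1.
Qed.

(** The real and imaginary parts of the remainder split into two terms each, and each of the four is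
    at most [N ^+ 2 * expR N]. *)
Lemma normc_expC_sub (z : C) :
  normc (expC z - 1 - z) <= 4 * normc z ^+ 2 * expR (normc z).
Proof.
have hx := normr_Re_le z; have hy := normr_Im_le z.
apply: le_trans (normc_le_ReIm _) _.
set N := normc z in hx hy *.
have N0 : 0 <= N := normc_ge0 z.
have -> : complex.Re (expC z - 1 - z) =
    (expR (complex.Re z) - 1 - complex.Re z) +
    expR (complex.Re z) * (cos (complex.Im z) - 1).
  by rewrite /expC; case: z {hx hy N N0} => x y /=; ring.
have -> : complex.Im (expC z - 1 - z) =
    expR (complex.Re z) * (sin (complex.Im z) - complex.Im z) +
    (expR (complex.Re z) - 1) * complex.Im z.
  by rewrite /expC; case: z {hx hy N N0} => x y /=; ring.
set x := complex.Re z in hx *; set y := complex.Im z in hy *.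
have eN : expR x <= expR N by rewrite ler_expR (le_trans (ler_norm x)).
have e'N : expR `|x| <= expR N by rewrite ler_expR.
have h1 : `|expR x - 1 - x| <= N ^+ 2 * expR N.
  apply: le_trans (normr_expR_sub x) _.
  by rewrite ler_pM ?expR_ge0 ?sqr_ge0 // lerXn2r ?nnegrE.
have y2 : `|y| ^+ 2 <= N ^+ 2 by rewrite lerXn2r ?nnegrE.
have h2 : `|expR x * (cos y - 1)| <= N ^+ 2 * expR N.
  rewrite normrM (ger0_norm (expR_ge0 _)) mulrC ler_pM ?expR_ge0 //.
  exact: le_trans (normr_cos_sub1 y) _.
have h3 : `|expR x * (sin y - y)| <= N ^+ 2 * expR N.
  rewrite normrM (ger0_norm (expR_ge0 _)) mulrC ler_pM ?expR_ge0 //.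
  exact: le_trans (normr_sin_sub y) _.
have h4 : `|(expR x - 1) * y| <= N ^+ 2 * expR N.
  rewrite normrM expr2 mulrAC ler_pM //.
  apply: le_trans (normr_expR_sub1 x) _.
  by rewrite ler_pM ?expR_ge0.
have := ler_normD (expR x - 1 - x) (expR x * (cos y - 1)).
have := ler_normD (expR x * (sin y - y)) ((expR x - 1) * y).
lra.
Qed.

End ExpC.

(** * Domination of Gaussian sums over the integers by a geometric series *)

Section Gauss.
Variable R : realType.
Local Notation C := R[i].

Lemma geometric_sum_le (r : R) (n : nat) : 0 <= r < 1 ->
  \sum_(0 <= i < n) r ^+ i <= (1 - r)^-1.
Proof.
move=> /andP[r0 r1].
have h : (1 - r) * (\sum_(0 <= i < n) r ^+ i) = 1 - r ^+ n.
  by rewrite -(opprB r 1) -(opprB (r ^+ n)) subrX1 big_mkord mulNr.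
rewrite -(ler_pM2l (_ : 0 < 1 - r)) ?subr_gt0 // h divff ?gt_eqF ?subr_gt0 //.
by rewrite gerBl exprn_ge0.
Qed.

Lemma sum_geometric_le (I : choiceType) (code : I -> nat) (r : R)
    (F : {fset I}) :
  injective code -> 0 <= r < 1 ->
  \sum_(i <- F) r ^+ code i <= (1 - r)^-1.
Proof.
move=> cinj /andP[r0 r1].
rewrite -(sum_fset_inj (fun n => r ^+ n) _ cinj).
set G := (code @` F)%fset.
have [N hN] : exists N, forall i, i \in G -> (i < N)%N.
  exists (\max_(i <- G) i).+1 => i iG; rewrite ltnS.
  exact: leq_bigmax_seq.
pose H : {fset nat} := [fset i | i in iota 0 N]%fset.
have GH : (G `<=` H)%fset.
  by apply/fsubsetP => i iG; rewrite in_fset /= mem_iota /= add0n hN.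
apply: (le_trans (sum_fset_le (fun i => exprn_ge0 i r0) GH)).
have -> : \sum_(i <- H) r ^+ i = \sum_(0 <= i < N) r ^+ i.
  rewrite /index_iota subn0 [LHS](perm_big (iota 0 N)) //.
  by apply: uniq_perm; rewrite ?fset_uniq ?iota_uniq // => i; rewrite in_fset.
by apply: geometric_sum_le; rewrite r0.
Qed.

(** With u = |n + a|, completing the square gives be u - al u^2 <= (be + 1)^2 / (4 al) - u. The
    integers are coded injectively by naturals at most 2|n|, so the remaining exp(- u) is below a
    multiple of a geometric term of ratio exp(- 1/2). *)
Lemma gauss_bound (al be a : R) : 0 < al ->
  exists M : R, forall F : {fset int},
    \sum_(n <- F) expR (- al * (n%:~R + a) ^+ 2 + be * `|n%:~R + a|) <= M.
Proof.
move=> al0.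
pose code (n : int) := match n with Posz m => m.*2 | Negz m => m.*2.+1 end.
have cinj : injective code by case=> m [] n /= h; [congr Posz|exfalso|exfalso|congr Negz]; lia.
pose K := (be + 1) ^+ 2 / (4 * al) + `|a|.
pose r : R := expR (- (1 / 2)).
have r01 : 0 <= r < 1 by rewrite expR_ge0 expR_lt1; lra.
exists (expR K * (1 - r)^-1) => F.
apply: (@le_trans _ _ (\sum_(n <- F) expR K * r ^+ code n)); last first.
  by rewrite -big_distrr ler_wpM2l ?expR_ge0 //; exact: sum_geometric_le.
apply: ler_sum => n _; rewrite -expRM_natr -expRD ler_expR.
have hc : (code n)%:R <= 2 * `|n%:~R| :> R.
  case: n => n /=; first by rewrite ger0_norm // -mul2n natrM lexx.
  rewrite NegzE mulrNz normrN ger0_norm ?ler0n //.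
  rewrite -[n.+1%:~R]/(n.+1%:R : R) -natrM ler_nat; lia.
have ha : `|n%:~R| <= `|n%:~R + a| + `|a| :> R.
  by have := ler_normB (n%:~R + a) a; rewrite addrK.
set y := n%:~R + a in ha *.
have -> : y ^+ 2 = `|y| ^+ 2 by rewrite real_normK ?num_real.
set u := `|y| in ha *.
have : 0 <= al * (u - (be + 1) / (2 * al)) ^+ 2.
  by rewrite mulr_ge0 ?sqr_ge0 // ltW.
have -> : al * (u - (be + 1) / (2 * al)) ^+ 2 =
    al * u ^+ 2 - (be + 1) * u + (be + 1) ^+ 2 / (4 * al).
  by field; rewrite gt_eqF.
rewrite /K; lra.
Qed.

End Gauss.

(** * Theta series and their derivatives *)

Section Tsum.
Variable R : realType.
Local Notation C := R[i].

(** Reduces termwise differentiation of a series to one summable quadratic bound on the Taylor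
    remainders. *)
Lemma quadratic_is_derive (f : C -> C) (x D : C) (M : R) :
  (forall h : C, normc h <= 1 -> normc (f (x + h) - f x - h * D) <= M * normc h ^+ 2) ->
  is_derive (x : C^o) (1 : C^o) (f : C^o -> C^o) D.
Proof.
move=> hf.
suff h : (fun h : C^o => h^-1 *: (f (h *: 1 + x) - f x) : C^o) @ 0^' --> (D : C^o).
  apply: DeriveDef; first by apply/cvg_ex; exists D.
  exact: (cvg_lim (@norm_hausdorff _ C^o) h).
apply/cvg_normcP => e e0.
(* The 1 keeps [h] in the range of the hypothesis; [|M| + 1] is positive and dominates [M]. *)
pose d := Num.min 1 (e / (`|M| + 1)).
have d0 : 0 < d by rewrite lt_min ltr01 divr_gt0 // ltr_wpDl.
have d0' : (0 : C) < d%:C by rewrite ltcR.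
have hd : \forall h \near (0 : C^o)^', h != 0 /\ normc h < d.
  have hn := @nbhs_dnbhs_neq C^o 0; have hl := @dnbhs0_lt C C^o _ d0'.
  by near=> h; split; [near: h|rewrite -ltr_normc; near: h].
near=> h.
have [h0 hhd] : h != 0 /\ normc h < d by near: h.
have [h1 h2] : normc h <= 1 /\ normc h < e / (`|M| + 1).
  by move: hhd; rewrite lt_min => /andP[/ltW].
have nh0 : 0 < normc h.
  by rewrite lt_neqAle normc_ge0 andbT eq_sym; apply: contra h0 => /eqP/eq0_normc ->.
have -> : h^-1 *: (f (h *: 1 + x) - f x) - D = h^-1 * (f (x + h) - f x - h * D).
  rewrite -[h *: 1]/(h * 1) mulr1 [h + x]addrC.
  rewrite -[LHS]/(h^-1 * _ - D); by field.
rewrite normcM normcV mulrC ltr_pdivrMr //.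
apply: le_lt_trans (hf _ h1) _.
rewrite expr2 mulrA ltr_pM2r //.
apply: (@le_lt_trans _ _ ((`|M| + 1) * normc h)).
  by rewrite ler_wpM2r ?normc_ge0 // (le_trans (ler_norm M)) // lerDl.
by rewrite mulrC -ltr_pdivlMr // ltr_wpDl.
Unshelve. all: by end_near. Qed.

(** The argument [v] stands for z + b: the lower entry of a characteristic is a translation of the
    argument. *)
Definition tterm (tau : C) (a : R) (v : C) (n : int) : C :=
  expC (pi%:C * 'i%C * (n%:~R + a%:C) ^+ 2 * tau
        + 2 * pi%:C * 'i%C * (n%:~R + a%:C) * v).

Definition tsum (tau : C) (a : R) (v : C) : C := csum (tterm tau a v).

Lemma intr_complex (n : int) : n%:~R = (n%:~R : R)%:C.
Proof. by rewrite rmorph_int. Qed.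

Lemma normc_tterm (tau : C) (a : R) (v : C) (n : int) :
  normc (tterm tau a v n) =
  expR (- (pi * complex.Im tau) * (n%:~R + a) ^+ 2
        - 2 * pi * complex.Im v * (n%:~R + a)).
Proof.
rewrite /tterm normc_expC intr_complex -rmorphD /= expr2.
congr expR; case: tau v => [t s] [x y].
by rewrite !(cReD, cReM, cImD, cImM) /=; ring.
Qed.

Lemma normc_tterm_le (tau : C) (a : R) (v : C) (n : int) :
  normc (tterm tau a v n) <=
  expR (- (pi * complex.Im tau) * (n%:~R + a) ^+ 2
        + 2 * pi * `|complex.Im v| * `|n%:~R + a|).
Proof.
rewrite normc_tterm ler_expR.
have h : - (complex.Im v * (n%:~R + a)) <= `|complex.Im v| * `|n%:~R + a|.
  by apply: le_trans (ler_norm _) _; rewrite normrN normrM.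
have := ler_wpM2l (mulr_ge0 (ler0n R 2) (pi_ge0 R)) h; lra.
Qed.

Lemma abs_summable_tterm (tau : C) (a : R) (v : C) : 0 < complex.Im tau ->
  abs_summable (tterm tau a v).
Proof.
move=> ht.
have [M hM] := @gauss_bound R (pi * complex.Im tau) (2 * pi * `|complex.Im v|) a
  (mulr_gt0 (pi_gt0 R) ht).
exists M => F; apply: le_trans (hM F).
by apply: ler_sum => n _; exact: normc_tterm_le.
Qed.

Lemma theta_tsum (tau : C) (a b : R) (z : C) : 0 < complex.Im tau ->
  theta a b z tau = tsum tau a (z + b%:C).
Proof. by move=> ht; rewrite /theta sumZ_csum //; exact: abs_summable_tterm. Qed.

Lemma normc_2piiy (y : R) : normc (2 * pi%:C * 'i%C * y%:C) = 2 * pi * `|y|.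
Proof.
rewrite 3!normcM !normc_real (ger0_norm (pi_ge0 R)).
have -> : normc ('i%C : C) = 1 by rewrite /= expr0n expr1n add0r sqrtr1.
rewrite mulr1; congr (_ * _ * _).
by rewrite -(rmorph_nat (real_complex R)) normc_real ger0_norm.
Qed.

(** The series differentiated term by term in [v]; [is_derive_tsum] identifies it with the
    derivative of [tsum]. *)
Definition dtsum (tau : C) (a : R) (v : C) : C :=
  csum (fun n => 2 * pi%:C * 'i%C * (n%:~R + a%:C) * tterm tau a v n).

Lemma abs_summable_dtterm (tau : C) (a : R) (v : C) : 0 < complex.Im tau ->
  abs_summable (fun n => 2 * pi%:C * 'i%C * (n%:~R + a%:C) * tterm tau a v n).
Proof.
move=> ht; have pi2 : 0 <= 2 * pi :> R by rewrite mulr_ge0 // pi_ge0.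
(* The extra 1 in the linear coefficient absorbs the factor |n + a|, which is at most exp |n +
   a|. *)
have [M hM] := @gauss_bound R _ (2 * pi * `|complex.Im v| + 1) a
  (mulr_gt0 (pi_gt0 R) ht).
exists (2 * pi * M) => F; apply: le_trans (ler_wpM2l pi2 (hM F)).
rewrite big_distrr /=; apply: ler_sum => n _.
rewrite normcM intr_complex -rmorphD normc_2piiy -[leLHS]mulrA ler_wpM2l //.
rewrite (mulrDl (2 * pi * _) 1) mul1r addrA expRD [leLHS]mulrC.
rewrite ler_pM ?normc_ge0 ?normc_tterm_le //.
by have := expR_ge1Dx `|n%:~R + a|; lra.
Qed.

Lemma is_derive_tsum (tau : C) (a : R) (v : C) : 0 < complex.Im tau ->
  is_derive (0 : C^o) (1 : C^o) (fun z : C^o => tsum tau a (v + z) : C^o)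
    (dtsum tau a v).
Proof.
move=> ht.
pose al := pi * complex.Im tau.
pose be := 2 * pi * `|complex.Im v|.
have al0 : 0 < al := mulr_gt0 (pi_gt0 R) ht.
(* In the remainder of the term with y = |n + a| the factor y^2 exp(2 pi y) appears for
   [normc h <= 1]. Since y^2 <= 2 exp y, raising the linear coefficient by [2 * pi + 1] absorbs
   it. *)
have [M hM] := @gauss_bound R al (be + (2 * pi + 1)) a al0.
have pi0 := pi_gt0 R.
have pi2 : 0 <= 2 * pi :> R by rewrite mulr_ge0 // ltW.
have g (n : int) (k : R) : 0 <= k ->
    k <= 2 * expR ((2 * pi + 1) * `|n%:~R + a|) ->
  normc (tterm tau a v n) * k <=
    2 * expR (- al * (n%:~R + a) ^+ 2 + (be + (2 * pi + 1)) * `|n%:~R + a|).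
  move=> k0 hk; set y := n%:~R + a in hk *.
  have -> : - al * y ^+ 2 + (be + (2 * pi + 1)) * `|y| =
    (- al * y ^+ 2 + be * `|y|) + (2 * pi + 1) * `|y| by ring.
  rewrite expRD [leRHS]mulrCA.
  by rewrite ler_pM ?normc_ge0 //; exact: normc_tterm_le.
have sq_exp (y : R) : 0 <= y ->
    y ^+ 2 * expR (2 * pi * y) <= 2 * expR ((2 * pi + 1) * y).
  move=> y0; have -> : (2 * pi + 1) * y = y + 2 * pi * y by ring.
  rewrite expRD mulrA ler_wpM2r ?expR_ge0 //.
  have := expR_ge1Dxn 1 y0; rewrite -[2`!%:R]/(2 : R); lra.
have gd := abs_summable_dtterm a v ht.
apply: (@quadratic_is_derive _ _ _ (4 * (2 * pi) ^+ 2 * (2 * M))) => h h1.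
rewrite add0r addr0.
have -> : tsum tau a (v + h) - tsum tau a v - h * dtsum tau a v =
  csum (fun n => tterm tau a v n *
    (expC (2 * pi%:C * 'i%C * (n%:~R + a%:C) * h) - 1
     - 2 * pi%:C * 'i%C * (n%:~R + a%:C) * h)).
  rewrite /tsum /dtsum -[- csum (tterm tau a v)]mulN1r -mulNr.
  rewrite -(csumZ (-1) (abs_summable_tterm a v ht)) -(csumZ (- h) gd).
  have sv := abs_summable_tterm a v ht.
  have svh := abs_summable_tterm a (v + h) ht.
  rewrite -csumD //; last exact: abs_summableZ.
  rewrite -csumD; [|by apply: abs_summableD => //; exact: abs_summableZ
                   |exact: abs_summableZ].
  congr csum; apply/funext => n.
  have -> : tterm tau a (v + h) n =
      tterm tau a v n * expC (2 * pi%:C * 'i%C * (n%:~R + a%:C) * h).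
    by rewrite /tterm -expCD; congr expC; ring.
  by ring.
apply: normc_csum_le => F.
have -> : 4 * (2 * pi) ^+ 2 * (2 * M) * normc h ^+ 2 =
  4 * (2 * pi) ^+ 2 * normc h ^+ 2 * (2 * M) by ring.
have K0 : 0 <= 4 * (2 * pi) ^+ 2 * normc h ^+ 2.
  by rewrite mulr_ge0 ?sqr_ge0 // mulr_ge0 ?sqr_ge0.
apply: le_trans (ler_wpM2l K0 (ler_wpM2l (ler0n R 2) (hM F))).
rewrite 2!big_distrr /=; apply: ler_sum => n _.
rewrite normcM.
have nE : normc (2 * pi%:C * 'i%C * (n%:~R + a%:C) * h) =
    2 * pi * `|n%:~R + a| * normc h.
  by rewrite normcM intr_complex -rmorphD normc_2piiy.
have y0 := normr_ge0 (n%:~R + a).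
set y := `|n%:~R + a| in nE y0 *.
apply: le_trans (ler_wpM2l (normc_ge0 _) (normc_expC_sub _)) _.
rewrite nE.
have -> : normc (tterm tau a v n) * (4 * (2 * pi * y * normc h) ^+ 2 *
   expR (2 * pi * y * normc h)) =
   4 * (2 * pi) ^+ 2 * normc h ^+ 2 *
   (normc (tterm tau a v n) * (y ^+ 2 * expR (2 * pi * y * normc h))) by ring.
rewrite ler_wpM2l //; apply: g; first by rewrite mulr_ge0 ?sqr_ge0 ?expR_ge0.
apply: le_trans (sq_exp _ y0); rewrite ler_wpM2l ?sqr_ge0 // ler_expR.
by rewrite ler_piMr // mulr_ge0.
Qed.

End Tsum.

(** * Quadratic relations *)

Section Identities.
Variable R : realType.
Local Notation C := R[i].

Lemma tsum_char_addint (tau : C) (a : R) (m : int) (v : C) :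
  0 < complex.Im tau -> tsum tau (a + m%:~R) v = tsum tau a v.
Proof.
move=> ht; have hb : bijective (fun n : int => n + m).
  by exists (fun n => n - m) => n; rewrite ?addrK ?subrK.
rewrite /tsum -(csum_bij hb (abs_summable_tterm a v ht)).
congr csum; apply/funext => n; rewrite /tterm /=; congr expC.
by rewrite !intr_complex intrD !rmorphD /=; ring.
Qed.

Lemma tsum_arg_addint (tau : C) (a : R) (m : int) (v : C) :
  0 < complex.Im tau ->
  tsum tau a (v + m%:~R) = expC (2 * pi%:C * 'i%C * a%:C * m%:~R) * tsum tau a v.
Proof.
move=> ht; rewrite /tsum -csumZ; last exact: abs_summable_tterm.
congr csum; apply/funext => n; rewrite /tterm -expCD.
by apply: (@expC_period _ _ _ (n * m)); rewrite rmorphM /=; ring.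
Qed.

Lemma tsumN (tau : C) (a : R) (v : C) :
  0 < complex.Im tau -> tsum tau (- a) (- v) = tsum tau a v.
Proof.
move=> ht; have hb : bijective (fun n : int => - n).
  by exists (fun n : int => - n) => n; rewrite opprK.
rewrite /tsum -(csum_bij hb (abs_summable_tterm a v ht)).
congr csum; apply/funext => n; rewrite /tterm /=; congr expC.
by rewrite rmorphN /= mulrNz; ring.
Qed.

(** Expanding (n + a + x)^2 turns a shift of the upper entry by x into a translation of the argument
    by x tau, up to an exponential factor. *)
Lemma tsum_char_add (tau : C) (a x : R) (v : C) :
  0 < complex.Im tau ->
  tsum tau (a + x) v =
  expC (pi%:C * 'i%C * x%:C ^+ 2 * tau + 2 * pi%:C * 'i%C * x%:C * v) *
  tsum tau a (v + x%:C * tau).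
Proof.
move=> ht; rewrite /tsum -csumZ; last exact: abs_summable_tterm.
congr csum; apply/funext => n; rewrite /tterm -expCD; congr expC.
by rewrite rmorphD /=; ring.
Qed.

Definition sigma (tau v : C) : C := tsum tau (1 / 2) (v + 1 / 2).

(** [inl] yields the pairs (m, n) with odd sum, [inr] those with even sum. On them (m + 1/2)^2 + (n
    + 1/2)^2 equals 2 (i^2 + (j + 1/2)^2) and 2 ((i + 1/2)^2 + j^2) respectively, whence the modulus
    2 tau and the upper entries 0 and 1/2. *)
Definition parity_split (p : int * int + int * int) : int * int :=
  match p with
  | inl (i, j) => (i + j, i - j - 1)
  | inr (i, j) => (i + j, i - j)
  end.

Lemma parity_split_bij : bijective parity_split.
Proof.
exists (fun p : int * int =>
  if ((p.1 + p.2) %% 2)%Z == 0 then inr (((p.1 + p.2) %/ 2)%Z, ((p.1 - p.2) %/ 2)%Z)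
  else inl (((p.1 + p.2 + 1) %/ 2)%Z, ((p.1 - p.2 - 1) %/ 2)%Z)).
  case=> -[i j] /=; case: ifP => /eqP h; try (exfalso; lia).
    by congr (inl (_, _)); lia.
  by congr (inr (_, _)); lia.
move=> [m n] /=; case: ifP => /eqP h /=; congr (_, _); lia.
Qed.

Lemma sigma_mul (tau u v : C) : 0 < complex.Im tau ->
  sigma tau u * sigma tau v =
  tsum (2 * tau) 0 (u + v) * tsum (2 * tau) (1 / 2) (u - v)
  - tsum (2 * tau) (1 / 2) (u + v) * tsum (2 * tau) 0 (u - v).
Proof.
move=> ht; have ht2 : 0 < complex.Im (2 * tau).
  by rewrite mulrDl mul1r cImD addr_gt0.
rewrite /sigma /tsum -!csum_prod; try exact: abs_summable_tterm.
set f := fun p : int * int => _.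
have af : abs_summable f by apply: abs_summable_prod; exact: abs_summable_tterm.
rewrite -(csum_bij parity_split_bij af) csum_sum; last first.
  exact: abs_summable_inj (bij_inj parity_split_bij) af.
rewrite -[X in _ = _ + X]mulN1r -csumZ; last first.
  by apply: abs_summable_prod; exact: abs_summable_tterm.
(* The two lower entries 1/2 contribute exp(pi i (m + n + 1)), which is 1 on the odd class and -1 on
   the even class. *)
congr (_ + _); congr csum; apply/funext => -[i j] /=; rewrite /f /tterm /= -!expCD.
  apply: (@expC_period _ _ _ i).
  rewrite !intr_complex !intrD !mulrNz !rmorphD !rmorphN /= rmorph1.
  by field.
rewrite mulN1r.
apply: (@expC_antiperiod _ _ _ i).
rewrite !intr_complex !intrD !mulrNz !rmorphD !rmorphN /=.
by field.
Qed.

(** Reflecting the index negates both entries 1/2; restoring the upper one by adding 1 is free,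
    restoring the lower one costs exp(pi i). *)
Lemma sigma_odd (tau v : C) : 0 < complex.Im tau ->
  sigma tau (- v) = - sigma tau v.
Proof.
move=> ht; rewrite /sigma -(tsumN _ (v + 1 / 2)) //.
rewrite -(tsum_char_addint (- (1 / 2)) 1) //.
have -> : - (1 / 2) + 1%:~R = 1 / 2 :> R by rewrite -[1%:~R]/(1 : R); field.
have -> : - v + 1 / 2 = - (v + 1 / 2) + 1%:~R.
  by rewrite -[1%:~R]/(1 : C); field.
rewrite tsum_arg_addint // (@expC_antiperiod _ _ 0 0) ?expC0 ?mulN1r //.
by rewrite rmorphM rmorphV /= ?unitfE // -[1%:~R]/(1 : C) -[0%:~R]/(0 : C); field.
Qed.

(* By [sigma_mul] both sides are products of the 2x2 minors
   [p, q] = A p * B q - B p * A q, and this is the Pluecker relation. *)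
Lemma sigma_three_term (tau w e : C) : 0 < complex.Im tau ->
  sigma tau (2 * w + e) * sigma tau e * sigma tau (2 * w) ^+ 2 =
  sigma tau w ^+ 2 * (sigma tau (3 * w + e) * sigma tau (- w + e))
  + sigma tau (w + e) ^+ 2 * (sigma tau (3 * w) * sigma tau w).
Proof.
move=> ht; rewrite !expr2 (sigma_mul (2 * w + e) e ht).
rewrite (sigma_mul (2 * w) (2 * w) ht) (sigma_mul w w ht).
rewrite (sigma_mul (3 * w + e) (- w + e) ht) (sigma_mul (w + e) (w + e) ht).
rewrite (sigma_mul (3 * w) w ht) !subrr.
have -> : 2 * w + e + e = 2 * w + 2 * e by ring.
have -> : 2 * w + e - e = 2 * w by ring.
have -> : 2 * w + 2 * w = 4 * w by ring.
have -> : w + w = 2 * w by ring.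
have -> : 3 * w + e + (- w + e) = 2 * w + 2 * e by ring.
have -> : 3 * w + e - (- w + e) = 4 * w by ring.
have -> : w + e + (w + e) = 2 * w + 2 * e by ring.
have -> : 3 * w + w = 4 * w by ring.
have -> : 3 * w - w = 2 * w by ring.
by ring.
Qed.

Definition dsigma (tau v : C) : C := dtsum tau (1 / 2) (v + 1 / 2).

Lemma is_derive_sigma (tau v : C) : 0 < complex.Im tau ->
  is_derive (0 : C^o) (1 : C^o) (fun z : C^o => sigma tau (v + z) : C^o)
    (dsigma tau v).
Proof.
move=> ht; have := is_derive_tsum (1 / 2) (v + 1 / 2) ht.
have -> // : (fun z : C^o => tsum tau (1 / 2) (v + 1 / 2 + z) : C^o) =
  (fun z : C^o => sigma tau (v + z) : C^o).
by apply/funext => z; rewrite /sigma addrAC.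
Qed.

Lemma dsigma_even (tau v : C) : 0 < complex.Im tau ->
  dsigma tau (- v) = dsigma tau v.
Proof.
move=> ht; have hb : bijective (fun n : int => - n - 1).
  by exists (fun n : int => - n - 1) => n; lia.
rewrite /dsigma /dtsum -(csum_bij hb (abs_summable_dtterm (1 / 2) (v + 1 / 2) ht)).
congr csum; apply/funext => n /=.
have nE : (- n - 1)%:~R = - n%:~R - 1 :> C by rewrite intrD !mulrNz.
have -> : tterm tau (1 / 2) (v + 1 / 2) (- n - 1) =
    - tterm tau (1 / 2) (- v + 1 / 2) n.
  by rewrite /tterm; apply: (@expC_antiperiod _ _ _ (- n - 1)); rewrite nE; field.
by rewrite nE; field.
Qed.

(** This is the derivative of [sigma_three_term] at [e = 0], where [sigma tau 0 = 0]. The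
    coefficient 3 is 2 from the square [sigma tau (w + e) ^+ 2] plus 1 from [sigma tau (- w + e)],
    whose derivative is even in [w]. *)
Lemma sigma_triple (tau w : C) : 0 < complex.Im tau ->
  dsigma tau 0 * sigma tau (2 * w) ^+ 3 =
  sigma tau w ^+ 2 *
  (3 * dsigma tau w * sigma tau (3 * w) - sigma tau w * dsigma tau (3 * w)).
Proof.
move=> ht.
pose s (v : C) : C^o -> C^o := fun z => sigma tau (v + z).
have ds v : is_derive (0 : C^o) (1 : C^o) (s v) (dsigma tau v).
  exact: is_derive_sigma.
have s0 v : s v 0 = sigma tau v by rewrite /s addr0.
have sigma0 : sigma tau 0 = 0.
  have := sigma_odd 0 ht; rewrite oppr0 => /eqP.
  by rewrite -addr_eq0 -mulr2n mulrn_eq0 /= => /eqP.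
pose k1 : C^o := sigma tau (2 * w) ^+ 2.
pose k2 : C^o := sigma tau w ^+ 2.
pose k3 : C^o := sigma tau (3 * w) * sigma tau w.
have E : (s (2 * w) * s 0) * cst k1 =
    cst k2 * (s (3 * w) * s (- w)) + (s w * s w) * cst k3 :> (C^o -> C^o).
  apply/funext => z; rewrite !fctE /s /k1 /k2 /k3 add0r -[_ * _ in X in _ + X * _]expr2.
  exact: sigma_three_term w z ht.
have D1 := is_deriveM (is_deriveM (ds (2 * w)) (ds 0)) (is_derive_cst k1 (0 : C^o) (1 : C^o)).
have D2 := is_deriveD (is_deriveM (is_derive_cst k2 (0 : C^o) (1 : C^o))
  (is_deriveM (ds (3 * w)) (ds (- w))))
  (is_deriveM (is_deriveM (ds w) (ds w)) (is_derive_cst k3 (0 : C^o) (1 : C^o))).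
rewrite E in D1.
case: D1 => _ D1; case: D2 => _; rewrite D1.
rewrite /= !fctE !s0 sigma0 sigma_odd // dsigma_even //.
rewrite /GRing.scale /= /k1 /k2 /k3 => h.
transitivity (sigma tau (2 * w) ^+ 2 * (sigma tau (2 * w) * dsigma tau 0)).
  by ring.
move: h; rewrite mulr0 mul0r addr0 add0r => ->.
by ring.
Qed.

End Identities.

(** * Nonvanishing of theta constants *)

Section GaussBinomial.
Variables (K : fieldType) (Q : K).

(** The Gaussian binomial coefficient, by the division-free q-Pascal rule. Where [N' - i']
    truncates, [gbin N' i'] is zero. *)
Fixpoint gbin (N i : nat) : K :=
  match i, N with
  | 0, _ => 1
  | _.+1, 0 => 0
  | i'.+1, N'.+1 => gbin N' i + Q ^+ (N' - i') * gbin N' i'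
  end.

(** The q-Pochhammer symbol (Q; Q)_n. *)
Definition qpoch (n : nat) : K := \prod_(0 <= k < n) (1 - Q ^+ k.+1).

Lemma gbin0 N : gbin N 0 = 1.
Proof. by case: N. Qed.

Lemma gbin_small N i : (N < i)%N -> gbin N i = 0.
Proof.
elim: N i => [|N IH] [|i] //= h.
by rewrite !IH ?mulr0 ?addr0 //; lia.
Qed.

Lemma gbinS N i : gbin N.+1 i.+1 = gbin N i.+1 + Q ^+ (N - i) * gbin N i.
Proof. by []. Qed.

Lemma qpochS n : qpoch n.+1 = qpoch n * (1 - Q ^+ n.+1).
Proof. by rewrite /qpoch big_nat_recr. Qed.

Lemma gbin_qpoch N i : (i <= N)%N ->
  gbin N i * (qpoch i * qpoch (N - i)) = qpoch N.
Proof.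
have q0 : qpoch 0 = 1 by rewrite /qpoch big_geq.
elim: N i => [|N IH] [|i] // h; rewrite ?gbin0 ?subn0 ?q0 ?mul1r //.
rewrite gbinS subSS mulrDl (qpochS N).
have -> : Q ^+ (N - i) * gbin N i * (qpoch i.+1 * qpoch (N - i)) =
    Q ^+ (N - i) * (1 - Q ^+ i.+1) * qpoch N.
  by rewrite -(IH i) // qpochS; ring.
have -> : gbin N i.+1 * (qpoch i.+1 * qpoch (N - i)) =
    (1 - Q ^+ (N - i)) * qpoch N.
  have [iN|iN] := ltnP i N.
    have E : (N - i = (N - i.+1).+1)%N by lia.
    by rewrite -(IH i.+1) // [in LHS]E (qpochS (N - i.+1)) -E; ring.
  by rewrite gbin_small // (_ : (N - i = 0)%N) ?expr0 ?subrr ?mul0r //; lia.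
have -> : Q ^+ N.+1 = Q ^+ (N - i) * Q ^+ i.+1.
  by rewrite -exprD; congr (_ ^+ _); lia.
by ring.
Qed.

(** The q-binomial theorem, with y^i Q^(i(i-1)/2) replaced by any sequence having the same
    successive ratios; consecutive theta terms form one. *)
Lemma gbin_theorem (N : nat) (y : K) (e : nat -> K) :
  (forall i, e i.+1 = y * Q ^+ i * e i) ->
  \sum_(0 <= i < N.+1) gbin N i * e i =
  e 0%N * \prod_(0 <= k < N) (1 + y * Q ^+ k).
Proof.
move=> he; elim: N => [|N IH].
  by rewrite big_nat1 big_geq // mul1r mulr1.
rewrite [in RHS]big_nat_recr //= mulrA -IH mulrDr mulr1.
rewrite big_nat_recl //; under eq_bigr do rewrite mulrDl.
rewrite big_split /= addrA; congr (_ + _).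
  rewrite -[X in X * e 0%N](gbin0 N) -(big_nat_recl _ _ (fun i => gbin N i * e i)) //.
  by rewrite big_nat_recr //= gbin_small // mul0r addr0.
rewrite big_distrl /=; apply: eq_big_nat => i /andP[_ iN].
rewrite he (_ : Q ^+ N = Q ^+ (N - i) * Q ^+ i); first by ring.
by rewrite -exprD subnK.
Qed.

End GaussBinomial.

(** * Upper and lower bounds for the partial products of (- c; Q)_oo *)

Section Products.
Variable R : realType.
Local Notation C := R[i].
Variables (Q : C) (Q1 : normc Q < 1).

Lemma normcX (z : C) (n : nat) : normc (z ^+ n) = normc z ^+ n.
Proof.
elim: n => [|n IH]; first by rewrite !expr0 normc1.
by rewrite !exprS normcM IH.
Qed.

Definition qprod (c : C) (n : nat) : C := \prod_(0 <= k < n) (1 + c * Q ^+ k).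

Lemma sum_powers_le (c : R) (n : nat) : 0 <= c ->
  \sum_(0 <= k < n) c * normc Q ^+ k <= c / (1 - normc Q).
Proof.
move=> c0; rewrite -big_distrr ler_wpM2l //=.
by apply: geometric_sum_le; rewrite normc_ge0.
Qed.

Lemma qprod_le (c : C) : exists M, forall n, normc (qprod c n) <= M.
Proof.
exists (expR (normc c / (1 - normc Q))) => n.
apply: le_trans (_ : expR (\sum_(0 <= k < n) normc c * normc Q ^+ k) <= _).
  rewrite /qprod; elim: n => [|n IH].
    by rewrite !big_geq // expR0 normc1.
  rewrite !big_nat_recr //= normcM expRD ler_pM ?normc_ge0 //.
  apply: le_trans (le_normcD _ _) _; rewrite normc1 normcM normcX.
  exact: expR_ge1Dx.
by rewrite ler_expR sum_powers_le ?normc_ge0.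
Qed.

(** Weierstrass's inequality: a product of factors 1 - u_k is at least 1 minus the sum of the
    u_k. *)
Lemma qprod_ge_small (c : C) (n : nat) :
  normc c / (1 - normc Q) <= 1 / 2 -> 1 / 2 <= normc (qprod c n).
Proof.
move=> hc; pose S n := \sum_(0 <= k < n) normc c * normc Q ^+ k.
have hS m : S m <= 1 / 2 by apply: le_trans hc; rewrite sum_powers_le ?normc_ge0.
suff : 1 - S n <= normc (qprod c n) by have := hS n; lra.
rewrite /qprod; elim: n => [|n IH].
  by rewrite /S !big_geq // normc1 subr0.
have := hS n.+1; rewrite /S !big_nat_recr //= -/(S n) normcM.
set u := normc c * _; have u0 : 0 <= u by rewrite mulr_ge0 ?exprn_ge0 ?normc_ge0.
have h1 : 1 - u <= normc (1 + c * Q ^+ n).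
  have := le_normcD (1 + c * Q ^+ n) (- (c * Q ^+ n)).
  by rewrite addrK normcN normc1 normcM normcX -/u; lra.
have S0 : 0 <= S n.
  by apply: sumr_ge0 => k _; rewrite mulr_ge0 ?exprn_ge0 ?normc_ge0.
move=> hSu; apply: le_trans (_ : (1 - S n) * (1 - u) <= _).
  by have := mulr_ge0 S0 u0; lra.
by apply: ler_pM => //; lra.
Qed.

Lemma positive_lower_bound (p : nat -> R) (K : nat) (d : R) :
  (forall n, 0 < p n) -> 0 < d -> (forall n, (K <= n)%N -> d <= p n) ->
  exists2 d', 0 < d' & forall n, d' <= p n.
Proof.
move=> p0; elim: K d => [|K IH] d d0 hd; first by exists d => // n; exact: hd.
apply: (IH (Num.min d (p K))); first by rewrite lt_min d0 p0.
move=> n; rewrite leq_eqVlt => /predU1P[<-|/hd h]; rewrite ge_min ?lexx ?orbT //.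
by rewrite h.
Qed.

(** After [K] factors the coefficient [c * Q ^+ K] is small enough for [qprod_ge_small]; the
    finitely many earlier partial products are nonzero. *)
Lemma qprod_ge (c : C) : (forall k, 1 + c * Q ^+ k != 0) ->
  exists2 d, 0 < d & forall n, d <= normc (qprod c n).
Proof.
move=> hc.
have nq n : 0 < normc (qprod c n).
  rewrite lt_neqAle normc_ge0 andbT eq_sym; apply/eqP => /eq0_normc /eqP.
  apply/negP; rewrite /qprod prodf_seq_neq0; apply/allP => k _ /=; exact: hc.
have q1 : 0 < 1 - normc Q by rewrite subr_gt0.
have [K hK] : exists K, normc c * normc Q ^+ K / (1 - normc Q) <= 1 / 2.
  have := @cvg_expr _ (normc Q : R); rewrite ger0_norm ?normc_ge0 // => /(_ Q1).
  have d0 : 0 < 2 * (normc c + 1) by have := normc_ge0 c; lra.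
  have e0 := divr_gt0 q1 d0.
  move=> /cvgrPdist_lt /(_ _ e0) [K _ /(_ K (leqnn K))] /=.
  rewrite sub0r normrN ger0_norm ?exprn_ge0 ?normc_ge0 //.
  rewrite ltr_pdivlMr // => h.
  exists K; rewrite ler_pdivrMr //.
  have := exprn_ge0 K (normc_ge0 Q); lra.
apply: (@positive_lower_bound _ K (normc (qprod c K) * (1 / 2))) => //.
  by rewrite mulr_gt0 // divr_gt0.
move=> n Kn.
have -> : qprod c n = qprod c K * qprod (c * Q ^+ K) (n - K).
  rewrite /qprod (big_cat_nat (leq0n K) Kn) //=; congr (_ * _).
  rewrite -{1}[K]add0n big_addn; apply: eq_bigr => i _.
  by rewrite addnC exprD mulrA.
rewrite normcM ler_wpM2l ?normc_ge0 // qprod_ge_small //.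
by rewrite normcM normcX.
Qed.

End Products.

(** * The finite triple product and its limit *)

Section Nonvanishing.
Variable R : realType.
Local Notation C := R[i].

Definition tratio (tau : C) (a : R) (v : C) (m : int) : C :=
  expC (2 * pi%:C * 'i%C * (m%:~R + a%:C + 1 / 2) * tau + 2 * pi%:C * 'i%C * v).

Lemma ttermS (tau : C) (a : R) (v : C) (m : int) :
  tterm tau a v (m + 1) = tratio tau a v m * tterm tau a v m.
Proof.
rewrite /tterm /tratio -expCD; congr expC.
by rewrite intrD -[1%:~R]/(1 : C); field.
Qed.

Definition nome2 (tau : C) : C := expC (2 * pi%:C * 'i%C * tau).

Lemma tratioD (tau : C) (a : R) (v : C) (m : int) (k : nat) :
  tratio tau a v (m + k%:Z) = tratio tau a v m * nome2 tau ^+ k.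
Proof.
rewrite /tratio /nome2 expCX -expCD; congr expC.
by rewrite intrD -[k%:~R]/(k%:R : C) -mulr_natr; ring.
Qed.

(** The q-binomial theorem of order 2n started at index -n. Pulling the ratio r out of each factor 1
    + r of negative index leaves 1 + r^-1 and carries the initial term from index -n to index 0. *)
Lemma finite_triple_product (tau : C) (a : R) (v : C) (n : nat) :
  \sum_(0 <= i < n.*2.+1)
     gbin (nome2 tau) n.*2 i * tterm tau a v (i%:Z - n%:Z) =
  tterm tau a v 0 * qprod (nome2 tau) (tratio tau a v (- 1))^-1 n
                  * qprod (nome2 tau) (tratio tau a v 0) n.
Proof.
set Q := nome2 tau; set e := tterm tau a v; set r := tratio tau a v.
have rne m : r m != 0 by exact: expC_neq0.
rewrite (@gbin_theorem _ Q n.*2 (r (- n%:Z)) (fun i => e (i%:Z - n%:Z))); last first.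
  move=> i; rewrite (_ : i.+1%:Z - n%:Z = (i%:Z - n%:Z) + 1); last by lia.
  by rewrite /e ttermS -tratioD (addrC (- _)).
rewrite sub0r -addnn (big_cat_nat (leq0n n) (leq_addr n n)) /= mulrA.
congr (_ * _); last first.
  rewrite -{1}[n]add0n big_addn addnK /qprod; apply: eq_bigr => i _.
  by rewrite -!tratioD; congr (1 + tratio _ _ _ _); lia.
rewrite big_nat_rev /= add0n.
under eq_big_nat => i /andP[_ hi].
  rewrite -tratioD (_ : - n%:Z + (n - i.+1)%:Z = - i.+1%:Z); last by lia.
  over.
elim: n => [|n IH]; first by rewrite /qprod !big_geq.
rewrite /qprod !big_nat_recr //= [RHS]mulrA -IH.
have -> : e (- n%:Z) = r (- n.+1%:Z) * e (- n.+1%:Z).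
  by rewrite -ttermS; congr tterm; lia.
have -> : (r (- 1))^-1 * Q ^+ n = (r (- n.+1%:Z))^-1.
  have -> : - (1 : int) = - n.+1%:Z + n%:Z by lia.
  by rewrite /r tratioD invfM -mulrA mulVf ?mulr1 // expf_neq0 ?expC_neq0.
rewrite -/r; field; exact: rne.
Qed.

Lemma normc_nome2 (tau : C) : 0 < complex.Im tau -> normc (nome2 tau) < 1.
Proof.
move=> ht; rewrite normc_expC expR_lt1.
have -> : complex.Re (2 * pi%:C * 'i%C * tau) = - (2 * pi * complex.Im tau).
  by case: tau {ht} => t s; rewrite !(cReM, cImM) /=; ring.
by rewrite oppr_lt0 !mulr_gt0 ?pi_gt0.
Qed.

Lemma qpoch_qprod (Q : C) (n : nat) : qpoch Q n = qprod Q (- Q) n.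
Proof. by rewrite /qpoch /qprod; apply: eq_bigr => i _; rewrite exprS mulNr. Qed.

Lemma qpoch_ge (Q : C) : normc Q < 1 ->
  exists2 d, 0 < d & forall n, d <= normc (qpoch Q n).
Proof.
move=> Q1; have [k|d d0 hd] := @qprod_ge _ Q Q1 (- Q).
  rewrite mulNr -exprS; apply/eqP => /eqP; rewrite subr_eq0 => /eqP h.
  have : normc (Q ^+ k.+1) < 1 by rewrite normcX exprn_ilt1 ?normc_ge0.
  by rewrite -h normc1 ltxx.
by exists d => // n; rewrite qpoch_qprod.
Qed.

(** The increments are dominated by a geometric series, and the partial products stay away from 0,
    hence so does the limit. *)
Lemma cvg_qpoch (Q : C) : normc Q < 1 ->
  exists2 L, L != 0 & (qpoch Q : nat -> C^o) @ \oo --> (L : C^o).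
Proof.
move=> Q1; have [M hM] := @qprod_le _ Q Q1 (- Q).
have [d d0 hd] := qpoch_ge Q1.
pose f n := qpoch Q n.+1 - qpoch Q n.
have fE n : normc (f n) <= M * normc Q ^+ n.
  rewrite /f qpochS mulrBr mulr1 addrAC subrr add0r normcN normcM normcX.
  rewrite ler_pM ?normc_ge0 ?exprn_ge0 ?normc_ge0 ?qpoch_qprod //.
  by rewrite exprS ler_piMl ?exprn_ge0 ?normc_ge0 // ltW.
have M0 : 0 <= M by apply: le_trans (hM 0%N); exact: normc_ge0.
have af : abs_summable f.
  exists (M * (1 - normc Q)^-1) => F.
  apply: le_trans (_ : \sum_(i <- F) M * normc Q ^+ i <= _).
    by apply: ler_sum => i _; exact: fE.
  rewrite -big_distrr ler_wpM2l //.
  by apply: (@sum_geometric_le _ _ id) => //; rewrite normc_ge0.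
have h := cvg_csum_nat af.
have hL : (qpoch Q : nat -> C^o) @ \oo --> (csum f + 1 : C^o).
  have -> : qpoch Q = (fun N => \sum_(0 <= n < N) f n + 1).
    apply/funext => N; rewrite /f telescope_sumr //.
    by rewrite [X in _ - X]/qpoch big_geq // subrK.
  exact: (@cvgD _ C^o _ _ _ _ _ _ _ h (cvg_cst (1 : C^o))).
exists (csum f + 1) => //; apply/eqP => L0; move: hL; rewrite L0.
move=> /cvg_normcP /(_ d d0) [N _ /(_ N (leqnn N))] /=.
by rewrite subr0 ltNge hd.
Qed.

Lemma qpoch_neq0 (Q : C) (n : nat) : normc Q < 1 -> qpoch Q n != 0.
Proof.
move=> Q1; have [d d0 /(_ n) hd] := qpoch_ge Q1; apply/eqP => h.
by move: hd; rewrite h normc0 leNgt d0.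
Qed.

(** The coefficient is (Q; Q)_2n / ((Q; Q)_(n+j) (Q; Q)_(n-j)), which tends to L / L^2. Once n >=
    |j| both indices are nonnegative and [absz] changes nothing. *)
Lemma cvg_gbin (Q L : C) (j : int) : normc Q < 1 -> L != 0 ->
  (qpoch Q : nat -> C^o) @ \oo --> (L : C^o) ->
  (fun n : nat => gbin Q n.*2 (absz (j + n%:Z)) : C^o) @ \oo --> (L^-1 : C^o).
Proof.
move=> Q1 L0 hL.
have h (u : nat -> nat) : (forall K, exists N, forall n, (N <= n)%N -> (K <= u n)%N) ->
    (fun n => qpoch Q (u n) : C^o) @ \oo --> (L : C^o).
  move=> hu; apply: (@cvg_comp _ _ _ u (qpoch Q : _ -> C^o) _ _ _ _ hL).
  move=> P [K _ hK]; have [N hN] := hu K.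
  by exists N => // n /= /hN; exact: hK.
have h1 := h (fun n => n.*2) (fun K => ex_intro _ K (fun n => _)).
have h2 : (fun n : nat => qpoch Q (absz (j + n%:Z)) : C^o) @ \oo --> (L : C^o).
  by apply: h => K; exists (absz j + K)%N => n; lia.
have h3 : (fun n : nat => qpoch Q (absz (n%:Z - j)) : C^o) @ \oo --> (L : C^o).
  by apply: h => K; exists (absz j + K)%N => n; lia.
have h4 : (fun n : nat => qpoch Q n.*2 *
    (qpoch Q (absz (j + n%:Z)) * qpoch Q (absz (n%:Z - j)))^-1 : C^o) @ \oo -->
    (L * (L * L)^-1 : C^o).
  apply: (@cvgM C); first by apply: h1; lia.
  apply: (@cvgV C); first by rewrite mulf_neq0.
  exact: (@cvgM C).
have E : L * (L * L)^-1 = L^-1 by rewrite invfM mulrA divff ?mul1r.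
rewrite E in h4.
apply: cvg_trans h4; apply: near_eq_cvg.
exists (absz j) => // n /= jn.
have hk : (absz (j + n%:Z)%R <= n.*2)%N by lia.
rewrite -(gbin_qpoch Q hk) (_ : (n.*2 - absz (j + n%:Z)%R)%N = absz (n%:Z - j)); last by lia.
by rewrite mulfK // mulf_neq0 // qpoch_neq0.
Qed.

Lemma gbin_bounded (Q : C) : normc Q < 1 ->
  exists M, forall N i, (i <= N)%N -> normc (gbin Q N i) <= M.
Proof.
move=> Q1; have [M hM] := @qprod_le _ Q Q1 (- Q).
have [d d0 hd] := qpoch_ge Q1.
exists (M / (d * d)) => N i iN.
rewrite ler_pdivlMr ?mulr_gt0 //.
apply: le_trans (hM N); rewrite -qpoch_qprod -(gbin_qpoch Q iN) !normcM.
by rewrite ler_wpM2l ?normc_ge0 // ler_pM ?hd // ltW.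
Qed.

(** By Tannery's theorem the left side of [finite_triple_product] tends to [L^-1 * tsum tau a v],
    while the right side stays bounded away from 0. *)
Lemma tsum_neq0 (tau : C) (a : R) (v : C) : 0 < complex.Im tau ->
  (forall m, 1 + tratio tau a v m != 0) -> tsum tau a v != 0.
Proof.
move=> ht hr; set Q := nome2 tau; have Q1 : normc Q < 1 := normc_nome2 ht.
have [L L0 hL] := cvg_qpoch Q1.
have [M hM] := gbin_bounded Q1.
pose psi (n : nat) : {fset int} :=
  [fset i%:Z - n%:Z | i in iota 0 n.*2.+1]%fset.
have psiP n (i : int) : (i \in psi n) = (absz i <= n)%N.
  have memE k : in_mem k (mem (iota 0 n.*2.+1)) = (k < n.*2.+1)%N.
    by rewrite mem_iota.
  apply/imfsetP/idP => [[k hk ->]|h].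
    by move: hk; rewrite memE; lia.
  by exists (absz (i + n%:Z)); rewrite ?memE; lia.
have cpsi : cofinal \oo psi.
  move=> A; exists (\max_(i <- A) (absz (i))) => // n /= An.
  apply/fsubsetP => i iA; rewrite psiP; apply: leq_trans An.
  exact: (@leq_bigmax_seq _ _ xpredT (fun i : int => (absz (i)))).
have hc : (fun n => fsum (fun i => gbin Q n.*2 (absz (i + n%:Z)) * tterm tau a v i)
    (psi n) : C^o) @ \oo --> (L^-1 * tsum tau a v : C^o).
  have hb n i : i \in psi n -> normc (gbin Q n.*2 (absz (i + n%:Z))) <= M.
    by rewrite psiP => hi; apply: hM; lia.
  exact: (@cvg_fsum_weighted R int (tterm tau a v) psi
    (fun n i => gbin Q n.*2 (absz (i + n%:Z))) L^-1 M
    (abs_summable_tterm a v ht) cpsi hb (fun i => cvg_gbin i Q1 L0 hL)).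
have fsumE n : fsum (fun i => gbin Q n.*2 (absz (i + n%:Z)) * tterm tau a v i)
    (psi n) = tterm tau a v 0 * qprod Q (tratio tau a v (- 1))^-1 n
                              * qprod Q (tratio tau a v 0) n.
  rewrite -finite_triple_product /fsum /index_iota subn0.
  rewrite [LHS](perm_big [seq i%:Z - n%:Z | i <- iota 0 n.*2.+1]).
    by rewrite big_map; apply: eq_bigr => i _; rewrite subrK.
  apply: uniq_perm; rewrite ?fset_uniq ?map_inj_uniq ?iota_uniq //.
    by move=> i j; lia.
  move=> i; rewrite psiP; apply/idP/mapP => [h|[k hk ->]].
    by exists (absz (i + n%:Z)); rewrite ?mem_iota; lia.
  by move: hk; rewrite mem_iota; lia.
(* These are the factors 1 + r^-1 with r a ratio of negative index; they vanish only where 1 + r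
   does. *)
have [k|d1 d1_gt0 hd1] := @qprod_ge _ Q Q1 (tratio tau a v (- 1))^-1.
  have rE : tratio tau a v (- 1) = tratio tau a v (- k.+1%:Z) * Q ^+ k.
    by rewrite -tratioD; congr tratio; lia.
  have Qk : Q ^+ k != 0 by rewrite expf_neq0 ?expC_neq0.
  have r0 : tratio tau a v (- k.+1%:Z) != 0 by exact: expC_neq0.
  rewrite rE invfM -mulrA mulVf // mulr1.
  have := hr (- k.+1%:Z); apply: contra => /eqP h; apply/eqP.
  by rewrite addrC -(mulVf r0) -[X in X + _]mul1r -mulrDl h mul0r.
have [k|d2 d2_gt0 hd2] := @qprod_ge _ Q Q1 (tratio tau a v 0).
  by rewrite -tratioD.
have n0 : 0 < normc (tterm tau a v 0) by rewrite normc_expC expR_gt0.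
apply/eqP => S0; rewrite S0 mulr0 in hc.
have d0 := mulr_gt0 (mulr_gt0 n0 d1_gt0) d2_gt0.
move/cvg_normcP: hc => /(_ _ d0) [N _ /(_ N (leqnn N))] /=.
rewrite subr0 fsumE normcM (normcM (tterm _ _ _ _)) ltNge => /negP; apply.
apply: ler_pM; [exact: ltW (mulr_gt0 n0 d1_gt0)|exact: ltW| |exact: hd2].
by apply: ler_pM; [exact: ltW|exact: ltW|exact: lexx|exact: hd1].
Qed.

End Nonvanishing.

(** * Rational characteristics *)

Section Characteristics.
Variable R : realType.
Local Notation C := R[i].

Lemma Re_expC_i (x : R) : complex.Re (expC ('i%C * x%:C)) = cos x :> R.
Proof.
rewrite /expC.
have -> : complex.Re ('i%C * x%:C) = 0 by rewrite /= mul0r mulr0 subrr.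
have -> : complex.Im ('i%C * x%:C) = x by rewrite /= mul0r add0r mul1r.
by rewrite expR0 mul1r.
Qed.

(** A ratio of modulus 1 forces m + a + 1/2 = 0, so m = -1 and a = 1/2. The ratio is then exp(2 pi i
    b), which on [0, 1) is -1 only at b = 1/2. *)
Lemma tratio_neqN1 (tau : C) (a b : R) (m : int) : 0 < complex.Im tau ->
  0 <= a < 1 -> 0 <= b < 1 -> (a, b) <> (1 / 2, 1 / 2) ->
  1 + tratio tau a b%:C m != 0.
Proof.
move=> ht /andP[a0 a1] /andP[b0 b1] hab; apply/eqP => h.
have hr : tratio tau a b%:C m = -1 by apply/eqP; rewrite -addr_eq0 addrC h.
have : expR (- (2 * pi * (m%:~R + a + 1 / 2) * complex.Im tau)) = 1.
  rewrite -[RHS](normc1 R) -[RHS]normcN -hr normc_expC; congr expR.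
  rewrite intr_complex; case: tau {ht h hr} => t s.
  by rewrite !(cReD, cReM, cImD, cImM) /=; field.
rewrite -[X in _ = X]expR0 => /expR_inj /eqP; rewrite oppr_eq0 => /eqP h0.
have p0 : 0 < 2 * pi * complex.Im tau by rewrite !mulr_gt0 ?pi_gt0.
have hm : m%:~R + a + 1 / 2 = 0 :> R.
  by apply: (mulIf (lt0r_neq0 p0)); rewrite mul0r -[RHS]h0; field.
have hm1 : m = -1.
  have h1 : (m%:~R : R) < 0 by lra.
  have h2 : (-2%:~R : R) < m%:~R by rewrite -[2%:~R]/(2 : R); lra.
  move: h1 h2; rewrite -[0]/(0%:~R) -mulrNz !ltr_int; lia.
have ha : a = 1 / 2 by move: hm; rewrite hm1 mulrNz -[1%:~R]/(1 : R); lra.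
move: hr; rewrite /tratio ha hm1.
have -> : 2 * pi%:C * 'i%C * ((-1)%:~R + (1 / 2)%:C + 1 / 2) * tau
   + 2 * pi%:C * 'i%C * b%:C = 'i%C * (2 * pi * b)%:C.
  by rewrite mulrNz -[1%:~R]/(1 : C); field.
move=> /(congr1 (@complex.Re R)); rewrite Re_expC_i /= => hc.
apply: hab; congr (_, _) => //.
(* Halving the angle brings it into [0, pi], where cosine is injective. *)
have : cos (pi * b) = cos (pi / 2).
  rewrite cos_pihalf.
  have : cos (2 * pi * b) = 2 * cos (pi * b) ^+ 2 - 1.
    by rewrite -mulrA mulrC mulr_natr cos_mulr2n mulr_natl.
  rewrite hc => h1; apply/eqP; rewrite -sqrf_eq0; apply/eqP; lra.
have pi0 := pi_gt0 R.
have i1 : pi * b \in `[0, pi].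
  have := mulr_ge0 (ltW pi0) b0; have := ler_wpM2l (ltW pi0) (ltW b1).
  by rewrite mulr1 in_itv /= => h1 h2; apply/andP.
have i2 : pi / 2 \in `[0, pi :> R] by rewrite in_itv /=; apply/andP; lra.
move=> /(cos_inj i1 i2) hb.
by apply: (mulfI (lt0r_neq0 pi0)); rewrite hb mul1r.
Qed.

Lemma dtsum_char_addint (tau : C) (a : R) (m : int) (v : C) :
  0 < complex.Im tau -> dtsum tau (a + m%:~R) v = dtsum tau a v.
Proof.
move=> ht; have hb : bijective (fun n : int => n + m).
  by exists (fun n => n - m) => n; rewrite ?addrK ?subrK.
rewrite /dtsum -(csum_bij hb (abs_summable_dtterm a v ht)).
congr csum; apply/funext => n /=.
have E : n%:~R + (a + m%:~R)%:C = (n + m)%:~R + a%:C :> C.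
  by rewrite !intr_complex intrD !rmorphD /=; ring.
by rewrite /tterm E.
Qed.

Lemma dtsum_arg_addint (tau : C) (a : R) (m : int) (v : C) :
  0 < complex.Im tau -> dtsum tau a (v + m%:~R) =
    expC (2 * pi%:C * 'i%C * a%:C * m%:~R) * dtsum tau a v.
Proof.
move=> ht; rewrite /dtsum -csumZ; last exact: abs_summable_dtterm.
congr csum; apply/funext => n; rewrite [RHS]mulrCA /tterm -expCD; congr (_ * _).
by apply: (@expC_period _ _ _ (n * m)); rewrite rmorphM /=; ring.
Qed.

Lemma dtsum_char_add (tau : C) (a x : R) (v : C) :
  0 < complex.Im tau ->
  dtsum tau (a + x) v =
  expC (pi%:C * 'i%C * x%:C ^+ 2 * tau + 2 * pi%:C * 'i%C * x%:C * v) *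
  (dtsum tau a (v + x%:C * tau)
   + 2 * pi%:C * 'i%C * x%:C * tsum tau a (v + x%:C * tau)).
Proof.
move=> ht; have a1 := abs_summable_dtterm a (v + x%:C * tau) ht.
have a2 := abs_summable_tterm a (v + x%:C * tau) ht.
rewrite /dtsum /tsum -csumZ // -csumD //; last first.
  exact: abs_summableZ.
rewrite -csumZ; last by apply: abs_summableD => //; exact: abs_summableZ.
congr csum; apply/funext => n; rewrite /tterm -mulrDl [RHS]mulrCA -expCD.
congr (_ * expC _); rewrite rmorphD /=; ring.
Qed.

(* With a = 1/2 + x and b = 1/2 + y, all theta functions below are exponential
   multiples of sigma at w = x tau + y, 2 w and 3 w, and this is
   [sigma_triple]. *)
Lemma tsum_triple (tau : C) (a b : R) : 0 < complex.Im tau ->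
  tsum tau a b%:C ^+ 2 *
  (3 * dtsum tau a b%:C * tsum tau (3 * a) (3 * b)%:C
   - tsum tau a b%:C * dtsum tau (3 * a) (3 * b)%:C) =
  dtsum tau (1 / 2) (1 / 2)%:C * expC (6 * pi%:C * 'i%C * a%:C) *
  tsum tau (1 / 2 - 2 * a) (1 / 2 - 2 * b)%:C ^+ 3.
Proof.
move=> ht; pose x := a - 1 / 2; pose y := b - 1 / 2.
pose w : C := x%:C * tau + y%:C.
have eh : expC (2 * pi%:C * 'i%C * (1 / 2)%:C * 1%:~R) = -1 :> C.
  by rewrite (@expC_antiperiod _ _ 0 0) ?expC0 // -[1%:~R]/(1 : C) mulr0; field.
have ehN : expC (2 * pi%:C * 'i%C * (1 / 2)%:C * (- 1)%:~R) = -1 :> C.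
  by rewrite (@expC_antiperiod _ _ 0 (- 1)) ?expC0 // mulrNz -[1%:~R]/(1 : C); field.
pose u1 : C := expC (pi%:C * 'i%C * x%:C ^+ 2 * tau + 2 * pi%:C * 'i%C * x%:C * b%:C).
pose u3 : C := expC (pi%:C * 'i%C * (3 * x)%:C ^+ 2 * tau
                     + 2 * pi%:C * 'i%C * (3 * x)%:C * (3 * b)%:C).
pose u2 : C := expC (pi%:C * 'i%C * (- 2 * x)%:C ^+ 2 * tau
                     + 2 * pi%:C * 'i%C * (- 2 * x)%:C * (1 / 2 - 2 * b)%:C).
have aE : a = 1 / 2 + x by rewrite /x; field.
have a3E : 3 * a = 1 / 2 + 3 * x + 1%:~R by rewrite /x -[1%:~R]/(1 : R); field.
have a2E : 1 / 2 - 2 * a = 1 / 2 + (- 2 * x) + (- 1)%:~R.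
  by rewrite /x mulrNz -[1%:~R]/(1 : R); field.
have v1E : b%:C + x%:C * tau = w + 1 / 2 by rewrite /w /y; field.
have v3E : (3 * b)%:C + (3 * x)%:C * tau = 3 * w + 1 / 2 + 1%:~R.
  by rewrite /w /y -[1%:~R]/(1 : C); field.
have v2E : (1 / 2 - 2 * b)%:C + (- 2 * x)%:C * tau = - (2 * w) + 1 / 2 + (- 1)%:~R.
  by rewrite /w /y mulrNz -[1%:~R]/(1 : C); field.
have T1 : tsum tau a b%:C = u1 * sigma tau w.
  by rewrite {1}aE tsum_char_add // v1E.
have D1 : dtsum tau a b%:C =
    u1 * (dsigma tau w + 2 * pi%:C * 'i%C * x%:C * sigma tau w).
  by rewrite {1}aE dtsum_char_add // v1E.
have T3 : tsum tau (3 * a) (3 * b)%:C = - u3 * sigma tau (3 * w).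
  by rewrite {1}a3E tsum_char_addint // tsum_char_add // v3E tsum_arg_addint // eh;
     rewrite /u3 /sigma; ring.
have D3 : dtsum tau (3 * a) (3 * b)%:C =
    - u3 * (dsigma tau (3 * w) + 2 * pi%:C * 'i%C * (3 * x)%:C * sigma tau (3 * w)).
  rewrite {1}a3E dtsum_char_addint // dtsum_char_add // v3E tsum_arg_addint //.
  by rewrite dtsum_arg_addint // eh /u3 /sigma /dsigma; ring.
have T2 : tsum tau (1 / 2 - 2 * a) (1 / 2 - 2 * b)%:C = u2 * sigma tau (2 * w).
  rewrite {1}a2E tsum_char_addint // tsum_char_add // v2E tsum_arg_addint // ehN.
  by rewrite -/(sigma tau (- (2 * w))) sigma_odd // /u2; ring.
have D0 : dtsum tau (1 / 2) (1 / 2)%:C = dsigma tau 0.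
  by rewrite /dsigma add0r; congr dtsum; field.
(* All exponential prefactors are compared here; the mismatch is the factor exp(6 pi i a) of the
   statement. *)
have U : - (u1 ^+ 3 * u3) = expC (6 * pi%:C * 'i%C * a%:C) * u2 ^+ 3.
  rewrite /u1 /u2 /u3 !expCX -!expCD; apply: (canLR opprK).
  apply: (@expC_antiperiod _ _ _ (- 2)).
  by rewrite /x mulrNz -[2%:~R]/(2 : C); field.
rewrite T1 D1 T3 D3 T2 D0.
(* The terms in 2 pi i x coming from [D1] and [D3] cancel, because 3 times the shift x equals the
   shift 3 x. *)
transitivity (- (u1 ^+ 3 * u3) * (sigma tau w ^+ 2 * (3 * dsigma tau w * sigma tau (3 * w)
   - sigma tau w * dsigma tau (3 * w)))).
  by rewrite rmorphM /=; ring.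
by rewrite U -sigma_triple //; ring.
Qed.

End Characteristics.

(** * Cyclic windows and the orbit under multiplication by 3 *)

Lemma prod_window_mod (S : comPzRingType) (t k : nat) (P : pred nat)
    (f : nat -> S) : (k < t)%N -> (forall l, f (l + t)%N = f l) ->
  \prod_(k <= l < t + k | P (l %% t)%N) f l = \prod_(0 <= l < t | P l) f l.
Proof.
move=> kt hf; rewrite (big_cat_nat (ltnW kt) (leq_addr k t)) /=.
rewrite [in RHS](big_cat_nat (leq0n k) (ltnW kt)) /= mulrC; congr (_ * _).
  (* As [k < t], the window wraps once: its indices from [t] on, shifted back by [t], fill the range
     below [k]. *)
  rewrite -{1}[t]add0n big_addn addKn big_nat_cond [RHS]big_nat_cond.
  apply: eq_big => [l|l _]; last exact: hf.
  by rewrite modnDr; case: ltnP => //= lk; rewrite modn_small // (ltn_trans lk).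
rewrite big_nat_cond [RHS]big_nat_cond; apply: eq_bigl => l.
by case: (l < t)%N / idP => lt; rewrite ?andbF //= modn_small.
Qed.

Lemma mul3_itv (x : rat) : 0 <= mul3 x < 1.
Proof.
rewrite mul3_floor subr_ge0 ltrBlDr addrC.
by have /andP[-> /=] := floor_itv (3 * x); rewrite intrD.
Qed.

Lemma iter_mul3c (n : nat) (c : rat * rat) :
  iter n mul3c c = (iter n mul3 c.1, iter n mul3 c.2).
Proof. by case: c => a b; elim: n => //= n ->. Qed.

Lemma iter_mul3_itv (n : nat) (x : rat) : 0 <= x < 1 -> 0 <= iter n mul3 x < 1.
Proof. by case: n => [|n] //= _; exact: mul3_itv. Qed.

Lemma mul3_half : mul3 (1 / 2) = 1 / 2.
Proof. by rewrite mul3_floor (_ : Num.floor _ = 1) //; exact: floor_def. Qed.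

Lemma iter_mul3c_half (n : nat) :
  iter n mul3c (1 / 2, 1 / 2) = (1 / 2, 1 / 2).
Proof. by elim: n => //= n ->; rewrite /mul3c /= mul3_half. Qed.

(** * Theta constants at rational characteristics *)

Section Final.
Variables (R : realType) (tau : R[i]).
Hypothesis htau : 0 < complex.Im tau.
Local Notation C := R[i].

Lemma ratrD_int (x : rat) (n : int) :
  ratr (x + n%:~R) = ratr x + n%:~R :> R.
Proof. by rewrite rmorphD /= ratr_int. Qed.

Lemma ratr_half : ratr (1 / 2) = 1 / 2 :> R.
Proof. by rewrite fmorph_div /= rmorph1 rmorph_nat. Qed.

Lemma ratr_triple (x : rat) : ratr (3 * x) = 3 * ratr x :> R.
Proof. by rewrite rmorphM /= rmorph_nat. Qed.

Lemma ratr_reflect (x : rat) : ratr (1 / 2 - 2 * x) = 1 / 2 - 2 * ratr x :> R.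
Proof. by rewrite rmorphB /= ratr_half rmorphM /= rmorph_nat. Qed.

Lemma thetanull_tsum (c : rat * rat) :
  thetanull c tau = tsum tau (ratr c.1) (ratr c.2)%:C.
Proof. by rewrite /thetanull theta_tsum // add0r. Qed.

Lemma dthetanull_dtsum (c : rat * rat) :
  dthetanull c tau = dtsum tau (ratr c.1) (ratr c.2)%:C.
Proof.
rewrite /dthetanull derive1E.
have [_ <-] := is_derive_tsum (ratr c.1) (ratr c.2)%:C htau.
suff -> : (fun z : C => theta (ratr c.1) (ratr c.2) z tau : C^o) =
  (fun z : C^o => tsum tau (ratr c.1) ((ratr c.2)%:C + z) : C^o) by [].
by apply/funext => z; rewrite theta_tsum // addrC.
Qed.

Lemma thetanull_neq0 (c : rat * rat) :
  0 <= c.1 < 1 -> 0 <= c.2 < 1 -> c <> (1 / 2, 1 / 2) -> thetanull c tau != 0.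
Proof.
have ratr_itv (x : rat) : 0 <= x < 1 -> 0 <= (ratr x : R) < 1.
  by rewrite ler0q -[X in _ -> _ && (_ < X)](rmorph1 (@ratr R)) ltr_rat.
case: c => a b /= /ratr_itv ha /ratr_itv hb hab.
rewrite thetanull_tsum; apply: tsum_neq0 => // m.
apply: tratio_neqN1 => // -[h1 h2]; apply: hab.
by move: h1 h2; rewrite -ratr_half => /fmorph_inj -> /fmorph_inj ->.
Qed.

Lemma thetanull_addint (a b : rat) (m n : int) :
  thetanull (a + m%:~R, b + n%:~R) tau =
  expC (2 * pi%:C * 'i%C * (ratr a)%:C * n%:~R) * thetanull (a, b) tau.
Proof.
by rewrite !thetanull_tsum /= !ratrD_int (rmorphD _ (ratr b)) /= -intr_complex
  tsum_char_addint // tsum_arg_addint.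
Qed.

Lemma dthetanull_addint (a b : rat) (m n : int) :
  dthetanull (a + m%:~R, b + n%:~R) tau =
  expC (2 * pi%:C * 'i%C * (ratr a)%:C * n%:~R) * dthetanull (a, b) tau.
Proof.
by rewrite !dthetanull_dtsum /= !ratrD_int (rmorphD _ (ratr b)) /= -intr_complex
  dtsum_char_addint // dtsum_arg_addint.
Qed.

Lemma thetanull_half : thetanull (1 / 2, 1 / 2) tau = 0.
Proof.
have := sigma_odd 0 htau; rewrite oppr0 thetanull_tsum /= ratr_half => /eqP.
rewrite -addr_eq0 -mulr2n mulrn_eq0 /= /sigma add0r => /eqP h.
by rewrite -[RHS]h; congr tsum; field.
Qed.

Lemma thetanull_triple (a b : rat) :
  thetanull (a, b) tau ^+ 2 *
  (3 * dthetanull (a, b) tau * thetanull (3 * a, 3 * b) tau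
   - thetanull (a, b) tau * dthetanull (3 * a, 3 * b) tau) =
  dthetanull (1 / 2, 1 / 2) tau * expC (6 * pi%:C * 'i%C * (ratr a)%:C) *
  thetanull (1 / 2 - 2 * a, 1 / 2 - 2 * b) tau ^+ 3.
Proof.
rewrite !thetanull_tsum !dthetanull_dtsum.
rewrite /= !ratr_triple !ratr_reflect ratr_half.
exact: (tsum_triple (ratr a) (ratr b) htau).
Qed.

(** [thetanull_triple] at the [j]-th characteristic, with the tripled and reflected entries reduced
    modulo integers. Integer shifts of upper entries are free; those of lower entries give the
    exponentials with floors of [3 ^+ j * b] and [3 ^+ j.+1 * b]. *)
Lemma thetanull_triple_iter (a b : rat) (j : nat) :
  0 <= a < 1 -> 0 <= b < 1 ->
  thetanull (iter j mul3c (a, b)) tau ^+ 2 *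
  (3 * dthetanull (iter j mul3c (a, b)) tau * thetanull (iter j.+1 mul3c (a, b)) tau
   - thetanull (iter j mul3c (a, b)) tau * dthetanull (iter j.+1 mul3c (a, b)) tau) =
  dthetanull (1 / 2, 1 / 2) tau *
  (expC (6 * pi%:C * 'i%C * (1 - (Num.floor (3 ^+ j * b))%:~R)
                   * (ratr (iter j mul3 a))%:C
                 - 2 * pi%:C * 'i%C * (Num.floor (3 ^+ j.+1 * b))%:~R
                   * (ratr (iter j.+1 mul3 a))%:C)
   * thetanull (1 / 2 - 2 * 3 ^+ j * a, 1 / 2 - 2 * 3 ^+ j * b) tau ^+ 3).
Proof.
move=> ha hb; rewrite !iter_mul3c.
set A := iter j mul3 a; set B := iter j mul3 b.
set A' := iter j.+1 mul3 a; set B' := iter j.+1 mul3 b.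
set F := Num.floor (3 ^+ j * b); set F' := Num.floor (3 ^+ j.+1 * b).
pose G := Num.floor (3 ^+ j * a); pose G' := Num.floor (3 ^+ j.+1 * a).
have AE : A = 3 ^+ j * a - G%:~R by exact: iter_mul3.
have BE : B = 3 ^+ j * b - F%:~R by exact: iter_mul3.
have A'E : A' = 3 ^+ j.+1 * a - G'%:~R by exact: iter_mul3.
have B'E : B' = 3 ^+ j.+1 * b - F'%:~R by exact: iter_mul3.
have A3 : 3 * A = A' + (G' - 3 * G)%:~R.
  by rewrite AE A'E exprS intrD mulrNz intrM -[3%:~R]/(3 : rat); ring.
have B3 : 3 * B = B' + (F' - 3 * F)%:~R.
  by rewrite BE B'E exprS intrD mulrNz intrM -[3%:~R]/(3 : rat); ring.
have A2 : 1 / 2 - 2 * A = 1 / 2 - 2 * 3 ^+ j * a + (2 * G)%:~R.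
  by rewrite AE intrM -[2%:~R]/(2 : rat); ring.
have B2 : 1 / 2 - 2 * B = 1 / 2 - 2 * 3 ^+ j * b + (2 * F)%:~R.
  by rewrite BE intrM -[2%:~R]/(2 : rat); ring.
have := thetanull_triple A B; rewrite A3 B3 A2 B2.
rewrite !thetanull_addint dthetanull_addint.
set e1 := expC (2 * pi%:C * 'i%C * (ratr A')%:C * _).
set e2 := expC (2 * pi%:C * 'i%C * _ * (2 * F)%:~R).
set T := thetanull (A, B) tau; set D := dthetanull (A, B) tau.
set T' := thetanull (A', B') tau; set D' := dthetanull (A', B') tau.
set U := thetanull _ tau; move=> h.
have e10 : e1 != 0 by exact: expC_neq0.
apply: (mulfI e10).
transitivity (T ^+ 2 * (3 * D * (e1 * T') - T * (e1 * D'))); first by ring.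
rewrite h exprMn.
set E := expC (_ - _).
suff e1E : e1 * E = expC (6 * pi%:C * 'i%C * (ratr A)%:C) * e2 ^+ 3.
  set d := dthetanull _ tau.
  transitivity (d * (expC (6 * pi%:C * 'i%C * (ratr A)%:C) * e2 ^+ 3) * U ^+ 3).
    by ring.
  by rewrite -e1E; ring.
rewrite /e1 /e2 /E expCX -!expCD.
have A3R : 3 * (ratr A)%:C = (ratr A')%:C + (G' - 3 * G)%:~R :> C.
  rewrite intr_complex -(rmorphD _ (ratr A')) /= -ratrD_int -A3.
  by rewrite ratr_triple; ring.
have A'R : (ratr A')%:C = 3 * (ratr A)%:C - (G' - 3 * G)%:~R :> C.
  by rewrite A3R addrK.
have A2R : (ratr (1 / 2 - 2 * 3 ^+ j * a))%:C =
    1 / 2 - 2 * (ratr A)%:C - (2 * G)%:~R :> C.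
  have -> : 1 / 2 - 2 * 3 ^+ j * a = 1 / 2 - 2 * A + (- (2 * G))%:~R.
    by rewrite A2 mulrNz addrK.
  by rewrite ratrD_int ratr_reflect (intr_complex R (2 * G)) mulrNz; field.
(* The two exponents differ by 2 pi i times this integer, which absorbs the integer parts of the
   upper entries. *)
apply: (@expC_period _ _ _ (3 * F * (G' + G - 1))).
by rewrite A2R A'R !(intrM, intrD, mulrNz) /=; field.
Qed.

End Final.

(** * Telescoping around the cycle *)

Lemma reflect_fixed (x : rat) (j : nat) : mul3 x = x ->
  exists m : int, 1 / 2 - 2 * 3 ^+ j * x = 1 / 2 + m%:~R.
Proof.
rewrite mul3_floor; set f := Num.floor _ => h.
(* A fixed point satisfies [2 * x = f], so the reflection moves 1/2 by an integer. *)
exists (- (3 ^+ j * f)); rewrite mulrNz intrM rmorphXn /=.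
have hf : 2 * x = f%:~R by rewrite -{1}h; lra.
by rewrite -hf; ring.
Qed.

(* The recursion reads 3 L j - L (j+1) = D0 * E j * V j / (th j ^ 3 * th (j+1))
   for L = d / th, and sum_j 3^(t-1+k-j) (3 L j - L (j+1)) telescopes to
   (3^t - 1) L k. For t = 1 the index j+1 is congruent to j, so that the
   products over l on the two sides only match because V vanishes. *)
Lemma periodic_recursion (K : numFieldType) (t k : nat) (th d E V : nat -> K)
    (D0 : K) : (k < t)%N ->
  (forall j, th (j + t)%N = th j) -> (forall j, d (j + t)%N = d j) ->
  (forall j, th j != 0) ->
  (forall j, th j ^+ 2 * (3 * d j * th j.+1 - th j * d j.+1) = D0 * (E j * V j)) ->
  (t = 1%N -> forall j, V j = 0) ->
  d k = ((3 ^+ t - 1) * \prod_(0 <= l < t) th l)^-1 * D0 * th k *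
    \sum_(k <= j < t + k)
      (3 ^+ (t - 1 + k - j) * E j * V j * th j ^- 2 *
       \prod_(k <= l < t + k | (l != j %[mod t]) && (l != j.+1 %[mod t])) th l).
Proof.
move=> hk thD dD th_neq0 hEV V1.
have t_gt0 : (0 < t)%N by apply: leq_ltn_trans hk.
pose L j := d j / th j.
have LE j : 3 * L j - L j.+1 = D0 * (E j * V j) / (th j ^+ 3 * th j.+1).
  by rewrite -hEV /L; field; rewrite !th_neq0.
pose P := \prod_(0 <= l < t) th l.
have P_neq0 : P != 0.
  by rewrite /P prodf_seq_neq0; apply/allP => l _; exact: th_neq0.
pose Q j := \prod_(k <= l < t + k | (l != j %[mod t]) && (l != j.+1 %[mod t])) th l.
have QE j : D0 * (3 ^+ (t - 1 + k - j) * E j * V j * th j ^- 2 * Q j) =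
    P * (3 ^+ (t - 1 + k - j) * (3 * L j - L j.+1)).
  have [t1|t2] := eqVneq t 1%N; first by rewrite LE V1 // !(mulr0, mul0r).
  have thm l : th (l %% t)%N = th l.
    rewrite [in RHS](divn_eq l t).
    by elim: (l %/ t)%N => // n IH; rewrite mulSn -addnA addnC thD.
  have PE : P = th j * th j.+1 * Q j.
    rewrite /Q (@prod_window_mod _ t k
      (fun l => (l != j %% t)%N && (l != j.+1 %% t)%N) th hk thD).
    have jt := ltn_pmod j t_gt0; have jt' := ltn_pmod j.+1 t_gt0.
    (* For t >= 2 the residues of j and j+1 differ, so both factors split off the product over a
       full period. *)
    have jj' : (j.+1 %% t != j %% t)%N.
      by rewrite -{2}[j]addn0 -addn1 eqn_modDl mod0n modn_small //; lia.
    rewrite /P !big_mkord (bigD1 (Ordinal jt)) //= thm -mulrA; congr (_ * _).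
    by rewrite (bigD1 (Ordinal jt')) /= ?thm.
  rewrite LE PE; move: (Q j) => q; field; by rewrite !th_neq0.
have SE : \sum_(k <= j < t + k) 3 ^+ (t - 1 + k - j) * (3 * L j - L j.+1) =
    (3 ^+ t - 1) * L k.
  (* Each summand is [u j.+1 - u j]. At the ends the exponents are [t] and 0, and periodicity gives
     [L (t + k) = L k]. *)
  pose u j := - (3 ^+ (t + k - j) * L j).
  have -> : (3 ^+ t - 1) * L k = u (t + k)%N - u k.
    by rewrite /u subnn addnK expr0 {2}/L addnC dD thD -/(L k); ring.
  rewrite -telescope_sumr ?leq_addl //; apply: eq_big_nat => j /andP[_ jt].
  rewrite /u; have -> : (t + k - j = (t - 1 + k - j).+1)%N by lia.
  have -> : (t + k - j.+1 = t - 1 + k - j)%N by lia.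
  by rewrite exprS; ring.
have t3 : 3 ^+ t - 1 != 0 :> K.
  by rewrite gt_eqF // subr_gt0 exprn_egt1 ?ltr1n // -lt0n.
rewrite -/P; set S := \sum_(k <= j < t + k) _.
have DS : D0 * S = P * ((3 ^+ t - 1) * L k).
  by rewrite -SE /S !big_distrr /=; apply: eq_bigr => j _; exact: QE.
transitivity (((3 ^+ t - 1) * P)^-1 * th k * (D0 * S)); last by ring.
by rewrite DS /L; field; rewrite P_neq0 t3 th_neq0.
Qed.

Theorem theorem2 (R : realType) (tau : R[i]) (htau : 0 < complex.Im tau)
    (a b : rat) (ha : 0 <= a < 1) (hb : 0 <= b < 1)
    (hab : (a, b) <> (1 / 2, 1 / 2))
    (t : nat) (ht : least_period (a, b) t) (k : nat) (hk : (k < t)%N) :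
  dthetanull (iter k mul3c (a, b)) tau =
    ((3 ^+ t - 1) * \prod_(0 <= l < t) thetanull (iter l mul3c (a, b)) tau)^-1
    * dthetanull (1 / 2, 1 / 2) tau
    * thetanull (iter k mul3c (a, b)) tau
    * \sum_(k <= j < t + k)
        (3 ^+ (t - 1 + k - j)
         * expC (6 * pi%:C * 'i%C * (1 - (Num.floor (3 ^+ j * b))%:~R)
                   * (ratr (iter j mul3 a))%:C
                 - 2 * pi%:C * 'i%C * (Num.floor (3 ^+ j.+1 * b))%:~R
                   * (ratr (iter j.+1 mul3 a))%:C)
         * thetanull (1 / 2 - 2 * 3 ^+ j * a, 1 / 2 - 2 * 3 ^+ j * b) tau ^+ 3
         * thetanull (iter j mul3c (a, b)) tau ^- 2
         * \prod_(k <= l < t + k | (l != j %[mod t]) && (l != j.+1 %[mod t]))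
             thetanull (iter l mul3c (a, b)) tau).
Proof.
have [t_gt0 ct _] := ht.
have cD j : iter (j + t) mul3c (a, b) = iter j mul3c (a, b) by rewrite iterD ct.
have th_neq0 j : thetanull (iter j mul3c (a, b)) tau != 0.
  apply: thetanull_neq0 => //; rewrite ?iter_mul3c; try exact: iter_mul3_itv.
  (* The characteristic (1/2, 1/2) is fixed by [mul3c]: an orbit reaching it stays there, yet it
     returns to [(a, b)] at every multiple of [t]. *)
  rewrite -iter_mul3c => h; apply: hab.
  have cM n : iter (n * t) mul3c (a, b) = (a, b).
    by elim: n => // n IH; rewrite mulSn addnC cD.
  by rewrite -(cM j) -(subnK (leq_pmulr j t_gt0)) iterD h iter_mul3c_half.
(* Both entries are then fixed, so the reflected characteristic is (1/2, 1/2) modulo integers, where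
   the theta constant vanishes by oddness. *)
have V1 : t = 1%N -> forall j,
    thetanull (1 / 2 - 2 * 3 ^+ j * a, 1 / 2 - 2 * 3 ^+ j * b) tau ^+ 3 = 0.
  move=> t1 j; have [fa fb] : mul3 a = a /\ mul3 b = b by move: ct; rewrite t1 => -[].
  have [m hm] := reflect_fixed j fa; have [n hn] := reflect_fixed j fb.
  by rewrite hm hn thetanull_addint // thetanull_half // mulr0 expr0n.
exact: (periodic_recursion hk
  (fun j => congr1 (fun c => thetanull c tau) (cD j))
  (fun j => congr1 (fun c => dthetanull c tau) (cD j))
  th_neq0 (fun j => thetanull_triple_iter htau j ha hb) V1).
Qed.
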